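(* Let $\varphi:\mathbb C^+\to\mathcal L(\mathcal U;\mathcal Y)$ be an operator Schur function and let $S_s$ be its conservative model with state space $\mathcal H_s$. For all $\alpha\in\mathbb C^+$, the following claims are true: 1. The Cayley transform with parameter $\alpha$ of $S_s$ is the unitary operator $\begin{bmatrix}\mathbf A_{s,\alpha}&\mathbf B_{s,\alpha}\\ \mathbf C_{s,\alpha}&\mathbf D_{s,\alpha}\end{bmatrix}:\begin{bmatrix}\mathcal H_s\\ \mathcal U\end{bmatrix}\to\begin{bmatrix}\mathcal H_s\\ \mathcal Y\end{bmatrix}$ given, for $\begin{bmatrix}h\\ \ell\end{bmatrix}\in\mathcal H_s$, $u\in\mathcal U$, $\mu,\mu_*\in\mathbb C^+$, by $$\Big(\mathbf A_{s,\alpha}\begin{bmatrix}h\\ \ell\end{bmatrix}\Big)(\mu,\mu_* )=\begin{bmatrix}\frac{\overline\alpha+\mu}{\alpha-\mu}h(\mu)-\frac{2\operatorname{Re}\alpha}{\alpha-\mu}h(\alpha)\\ \frac{\overline\alpha-\mu_*}{\alpha+\mu_*}\ell(\mu_* )-\frac{2\operatorname{Re}\alpha}{\alpha+\mu_*}\widetilde\varphi(\mu_* )h(\alpha)\end{bmatrix},$$ $$(\mathbf B_{s,\alpha}u)(\mu,\mu_* )=\sqrt{2\operatorname{Re}\alpha}\begin{bmatrix}\frac{\varphi(\mu)-\varphi(\alpha)}{\alpha-\mu}u\\ K_c(\mu_*,\overline\alpha)u\end{bmatrix},\quad\mathbf C_{s,\alpha}\begin{bmatrix}h\\ \ell\end{bmatrix}=\sqrt{2\operatorname{Re}\alpha}\,h(\alpha),\quad\mathbf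 D_{s,\alpha}u=\varphi(\alpha)u.$$ 2. The unitary operator $\Xi_{s,\alpha}:\mathbf H_s\to\mathcal H_s$ given by $$\Big(\Xi_{s,\alpha}\begin{bmatrix}f\\ g\end{bmatrix}\Big)(\mu,\mu_* )=\sqrt{2\operatorname{Re}\alpha}\begin{bmatrix}\frac{f(m_\alpha^{-1}(\mu))}{\overline\alpha+\mu}\\ \frac{g(m_{\overline\alpha}^{-1}(\mu_* ))}{\alpha+\mu_*}\end{bmatrix}$$ implements a unitary similarity between the operator in item 1 and the classical de Branges--Rovnyak operator $\begin{bmatrix}\mathbf A_s&\mathbf B_s\\ \mathbf C_s&\mathbf D_s\end{bmatrix}$ built for $\phi(z):=\varphi(m_\alpha(z))$, $z\in\mathbb D$: $$\begin{bmatrix}\mathbf A_{s,\alpha}\Xi_{s,\alpha}&\mathbf B_{s,\alpha}\\ \mathbf C_{s,\alpha}\Xi_{s,\alpha}&\mathbf D_{s,\alpha}\end{bmatrix}=\begin{bmatrix}\Xi_{s,\alpha}\mathbf A_s&\Xi_{s,\alpha}\mathbf B_s\\ \mathbf C_s&\mathbf D_s\end{bmatrix}.$$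
   Context: All Hilbert spaces are complex; $\begin{bmatrix}\mathcal X\\ \mathcal U\end{bmatrix}$ is the orthogonal direct sum; $1$ denotes an identity operator; $\mathbb C^+=\{\operatorname{Re}\lambda>0\}$, $\mathbb D$ is the open unit disk. $\mathcal U,\mathcal Y$ are separable Hilbert spaces. A Schur function is analytic with contractive values. $\widetilde\varphi(\mu):=\varphi(\overline\mu)^*$, $K_c(\mu,\lambda)=\frac{1-\widetilde\varphi(\mu)\widetilde\varphi(\lambda)^*}{\mu+\overline\lambda}$. Removable singularities are removed by continuity. $\mathcal H_s$ is the RKHS of functions $(\mu,\mu_* )\mapsto\begin{bmatrix}x_1(\mu)\\ x_2(\mu_* )\end{bmatrix}\in\begin{bmatrix}\mathcal Y\\ \mathcal U\end{bmatrix}$ on $\mathbb C^+\times\mathbb C^+$ with (positive) reproducing kernel $$K_s(\mu,\mu_*,\lambda,\lambda_* )=\begin{bmatrix}\frac{1-\varphi(\mu)\varphi(\lambda)^*}{\mu+\overline\lambda}&\frac{\varphi(\overline{\lambda_*})-\varphi(\mu)}{\mu-\overline{\lambda_*}}\\ \frac{\widetilde\varphi(\overline\lambda)-\widetilde\varphi(\mu_* )}{\mu_*-\overline\lambda}&\frac{1-\widetilde\varphi(\mu_* )\widetilde\varphi(\lambda_* )^*}{\mu_*+\overline{\lambda_*}}\end{bmatrix}.$$ The model $S_s=\begin{bmatrix}A_s\&B_s\\ C_s\&D_s\end{bmatrix}:\begin{bmatrix}\mathcal H_s\\ \mathcal U\end{bmatrix}\supset\mathrm{dom}(S_s)\to\begin{bmatrix}\mathcal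 H_s\\ \mathcal Y\end{bmatrix}$: $\begin{bmatrix}x\\ u\end{bmatrix}\in\mathrm{dom}(S_s)$ iff there is a (unique) $y\in\mathcal Y$ such that $\begin{bmatrix}z_1(\mu)\\ z_2(\mu_* )\end{bmatrix}:=\begin{bmatrix}\mu x_1(\mu)\\ -\mu_*x_2(\mu_* )\end{bmatrix}+\begin{bmatrix}\varphi(\mu)\\ 1\end{bmatrix}u-\begin{bmatrix}1\\ \widetilde\varphi(\mu_* )\end{bmatrix}y$ defines an element of $\mathcal H_s$, and then $S_s\begin{bmatrix}x\\ u\end{bmatrix}=\begin{bmatrix}z\\ y\end{bmatrix}$. It is a conservative system node with transfer function $\varphi$. For a passive system node $S=\begin{bmatrix}A\&B\\ C\&D\end{bmatrix}$ with state space $\mathcal X$: the main operator is $Ax=A\&B\begin{bmatrix}x\\ 0\end{bmatrix}$, $\mathrm{dom}(A)=\{x:\begin{bmatrix}x\\ 0\end{bmatrix}\in\mathrm{dom}(S)\}$, and $\mathbb C^+\subset\mathrm{res}(A)$; the observation operator is $Cx=C\&D\begin{bmatrix}x\\ 0\end{bmatrix}$ on $\mathrm{dom}(A)$; $A_{-1}$ is the extension of $A$ to $\mathcal X$ with values in the completion $\mathcal X_{-1}$ of $\mathcal X$ in the norm $\|(\beta-A)^{-1}x\|$ ($\beta\in\mathbb C^+$ fixed); the control operator is the unique $B\in\mathcal L(\mathcal U;\mathcal X_{-1})$ with $A\&B=\begin{bmatrix}A_{-1}&B\end{bmatrix}|_{\mathrm{dom}(S)}$; the transfer function is $\widehat D(\lambda)=C\&D\begin{bmatrix}(\lambda-A_{-1})^{-1}B\\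 1\end{bmatrix}$. The Cayley transform of $S$ with parameter $\alpha\in\mathbb C^+$ is the operator $\begin{bmatrix}(\overline\alpha+A)(\alpha-A)^{-1}&\sqrt{2\operatorname{Re}\alpha}\,(\alpha-A_{-1})^{-1}B\\ \sqrt{2\operatorname{Re}\alpha}\,C(\alpha-A)^{-1}&\widehat D(\alpha)\end{bmatrix}$. $m_\alpha(z)=\frac{\alpha-\overline\alpha z}{1+z}$ maps $\mathbb D$ bijectively onto $\mathbb C^+$, with $m_\alpha^{-1}(\mu)=\frac{\alpha-\mu}{\overline\alpha+\mu}$. Classical model: for a Schur function $\phi$ on $\mathbb D$, $\mathbf H_s$ is the RKHS of $\begin{bmatrix}\mathcal Y\\ \mathcal U\end{bmatrix}$-valued functions on $\mathbb D$ with kernel $\begin{bmatrix}\frac{1-\phi(z)\phi(w)^*}{1-z\overline w}&\frac{\phi(z)-\phi(\overline w)}{z-\overline w}\\ \frac{\phi(\overline z)^*-\phi(w)^*}{z-\overline w}&\frac{1-\phi(\overline z)^*\phi(\overline w)}{1-z\overline w}\end{bmatrix}$, and $\begin{bmatrix}\mathbf A_s&\mathbf B_s\\ \mathbf C_s&\mathbf D_s\end{bmatrix}:\begin{bmatrix}\mathbf H_s\\ \mathcal U\end{bmatrix}\to\begin{bmatrix}\mathbf H_s\\ \mathcal Y\end{bmatrix}$ is the unitary operator with $\big(\mathbf A_s\begin{bmatrix}f\\ g\end{bmatrix}\big)(z)=\begin{bmatrix}\frac{f(z)-f(0)}z\\ zg(z)-\phi(\overline z)^*f(0)\end{bmatrix}$,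 $(\mathbf B_su)(z)=\begin{bmatrix}\frac{\phi(z)-\phi(0)}z\\ 1-\phi(\overline z)^*\phi(0)\end{bmatrix}u$, $\mathbf C_s\begin{bmatrix}f\\ g\end{bmatrix}=f(0)$, $\mathbf D_su=\phi(0)u$. *)

(* Defs.v *)
From HB Require Import structures.
From mathcomp Require Import all_boot all_order all_algebra complex.
From mathcomp Require Import all_classical all_reals topology normedtype.
From mathcomp Require Import ring.

Set Implicit Arguments.
Unset Strict Implicit.
Unset Printing Implicit Defensive.
Import Order.TTheory GRing.Theory Num.Theory.
Import numFieldNormedType.Exports.
Local Open Scope classical_set_scope.
Local Open Scope ring_scope.

(* R[i] wrapped as a numClosedFieldType: the topology of MathComp-Analysis on
   a numFieldType is found by unification for [Cplx R] but not for the raw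
   type [R[i]] *)
Definition Cplx (R : realType) : numClosedFieldType := R[i].

HB.mixin Record isHilbert (R : realType) H of CompleteNormedModule (Cplx R) H := {
  hdot : {dot H for @Num.conj (Cplx R)};
  hdot_norm : forall x : H, `|x| ^+ 2 = hdot x x
}.

#[short(type="hilbertType")]
HB.structure Definition Hilbert (R : realType) :=
  {H of CompleteNormedModule (Cplx R) H & isHilbert R H}.

Definition dsum (R : realType) (X U : hilbertType R) : Type := (X * U)%type.

Section DirectSum.
Variables (R : realType) (X U : hilbertType R).
Local Notation C := (Cplx R).
Local Notation V := (dsum X U).

HB.instance Definition _ := GRing.Lmodule.copy V (X * U)%type.

Definition dsum_dot (v w : V) : C := hdot v.1 w.1 + hdot v.2 w.2.
Definition dsum_norm (v : V) : C := sqrtC (dsum_dot v v).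

Lemma dsum_dotE (v : V) : dsum_dot v v = `|v.1| ^+ 2 + `|v.2| ^+ 2.
Proof. by rewrite !hdot_norm. Qed.

Lemma dsum_norm_ge0 (v : V) : 0 <= dsum_norm v.
Proof. by rewrite sqrtC_ge0 dsum_dotE addr_ge0// exprn_ge0. Qed.

Lemma dsum_norm_sqr (v : V) : dsum_norm v ^+ 2 = `|v.1| ^+ 2 + `|v.2| ^+ 2.
Proof. by rewrite sqrtCK dsum_dotE. Qed.

Lemma dsum_ler_normD (v w : V) : dsum_norm (v + w) <= dsum_norm v + dsum_norm w.
Proof.
have nn := @dsum_norm_ge0.
have eqE (a b : C) : 0 <= a -> 0 <= b -> (a <= b) = (a ^+ 2 <= b ^+ 2).
  by move=> a0 b0; rewrite ler_pXn2r.
rewrite eqE ?addr_ge0// sqrrD !dsum_norm_sqr.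
set a := `|v.1|; set b := `|v.2|; set c := `|w.1|; set d := `|w.2|.
have [a0 b0 c0 d0] : [/\ 0 <= a, 0 <= b, 0 <= c & 0 <= d] by rewrite !normr_ge0.
have CS : a * c + b * d <= dsum_norm v * dsum_norm w.
  rewrite eqE ?mulr_ge0 ?addr_ge0 ?mulr_ge0// exprMn !dsum_norm_sqr -/a -/b -/c -/d.
  rewrite -subr_ge0.
  have -> : (a ^+ 2 + b ^+ 2) * (c ^+ 2 + d ^+ 2) - (a * c + b * d) ^+ 2 =
            (a * d - b * c) ^+ 2 by ring.
  by apply: real_exprn_even_ge0 => //; rewrite realB ?realM ?ger0_real.
apply: (@le_trans _ _ ((a + c) ^+ 2 + (b + d) ^+ 2)).
  by apply: lerD; rewrite ler_pXn2r ?nnegrE ?addr_ge0//= ler_normD.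
rewrite -subr_ge0 -/a -/b -/c -/d; set e := dsum_norm v * dsum_norm w in CS *.
have -> : a ^+ 2 + b ^+ 2 + e *+ 2 + (c ^+ 2 + d ^+ 2) -
   ((a + c) ^+ 2 + (b + d) ^+ 2) = (e - (a * c + b * d)) *+ 2 by ring.
by rewrite mulrn_wge0// subr_ge0.
Qed.

Lemma dsum_normrZ (l : C) (v : V) : dsum_norm (l *: v) = `|l| * dsum_norm v.
Proof.
apply/eqP; rewrite -(@eqrXn2 _ 2) ?mulr_ge0 ?dsum_norm_ge0//.
by rewrite exprMn !dsum_norm_sqr/= !normrZ !exprMn mulrDr.
Qed.

Lemma dsum_normr0_eq0 (v : V) : dsum_norm v = 0 -> v = 0.
Proof.
move=> v0; have := dsum_norm_sqr v; rewrite v0 expr0n/= => /esym/eqP.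
rewrite paddr_eq0 ?exprn_ge0// !sqrf_eq0 !normr_eq0.
by case: v {v0} => x u /= /andP[/eqP-> /eqP->].
Qed.

HB.instance Definition _ :=
  Lmodule_isNormed.Build C V dsum_ler_normD dsum_normrZ dsum_normr0_eq0.

Lemma dsum_normE (v : V) : `|v| = dsum_norm v. Proof. by []. Qed.

Lemma dsum_norm_fst (v : V) : `|v.1| <= `|v|.
Proof.
rewrite -(@ler_pXn2r _ 2) ?nnegrE// dsum_normE dsum_norm_sqr.
by rewrite lerDl exprn_ge0.
Qed.

Lemma dsum_norm_snd (v : V) : `|v.2| <= `|v|.
Proof.
rewrite -(@ler_pXn2r _ 2) ?nnegrE// dsum_normE dsum_norm_sqr.
by rewrite lerDr exprn_ge0.
Qed.

Lemma dsum_norm_le (v : V) : `|v| <= `|v.1| + `|v.2|.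
Proof.
rewrite -(@ler_pXn2r _ 2) ?nnegrE ?addr_ge0// dsum_normE dsum_norm_sqr sqrrD.
by rewrite addrAC lerDl mulrn_wge0// mulr_ge0.
Qed.

Lemma dsum_cauchy_cvg (F : set_system V) :
  ProperFilter F -> cauchy F -> cvg F.
Proof.
move=> FF Fc.
have part (W : hilbertType R) (p : {linear V -> W}) :
    (forall v, `|p v| <= `|v|) -> cvg (p @ F).
  move=> pv; apply: cauchy_cvg; apply/cauchy_ballP => e e0.
  have /cauchy_ballP/(_ _ e0) := Fc.
  rewrite !near_simpl => h; rewrite near_map2.
  apply: filterS h => -[v w] /=; rewrite -!ball_normE/= => vw.
  by rewrite -linearB (le_lt_trans (pv _)).
have /cvg_ex[x Fx] : cvg ((fst : V -> X) @ F).
  pose p : V -> X := fst.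
  have pl : linear p by [].
  pose P := GRing.isLinear.Build _ _ _ _ p pl.
  pose q : {linear V -> X} := HB.pack p P.
  exact: (part X q dsum_norm_fst).
have /cvg_ex[u Fu] : cvg ((snd : V -> U) @ F).
  pose p : V -> U := snd.
  have pl : linear p by [].
  pose P := GRing.isLinear.Build _ _ _ _ p pl.
  pose q : {linear V -> U} := HB.pack p P.
  exact: (part U q dsum_norm_snd).
apply/cvg_ex; exists (x, u); apply/(@fcvgrPdist_lt _ V) => e e0.
have e20 : 0 < e / 2 by rewrite divr_gt0.
move/cvgrPdist_lt : Fx => /(_ _ e20) hx.
move/cvgrPdist_lt : Fu => /(_ _ e20) hu.
near=> v; apply: le_lt_trans (dsum_norm_le _) _; rewrite (splitr e).
by apply: ltrD; near: v.
Unshelve. all: by end_near. Qed.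

HB.instance Definition _ := Uniform_isComplete.Build V dsum_cauchy_cvg.

Lemma dsum_dot_bilinear :
  bilinear_for (@GRing.mul C) (Num.conj \; @GRing.mul C) dsum_dot.
Proof.
split=> w a x y; rewrite /dsum_dot/=.
  by rewrite !linearPl/=; ring.
by rewrite !linearPr/=; ring.
Qed.

HB.instance Definition _ := bilinear_isBilinear.Build C V V C
  (@GRing.mul C) (Num.conj \; @GRing.mul C) dsum_dot dsum_dot_bilinear.

Lemma dsum_dot_hermitian (v w : V) :
  dsum_dot v w = (-1) ^+ false * (dsum_dot w v)^*.
Proof.
rewrite /dsum_dot expr0 mul1r rmorphD/= (hermC _ v.1) (hermC _ v.2).
by rewrite !expr0 !mul1r.
Qed.

HB.instance Definition _ := isHermitianSesquilinear.Build C V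
  false (@Num.conj C) dsum_dot dsum_dot_hermitian.

Lemma dsum_dot_gt0 (v : V) : v != 0 -> 0 < dsum_dot v v.
Proof.
move=> v0; rewrite lt_def dsum_dotE addr_ge0 ?exprn_ge0// andbT.
by rewrite -dsum_norm_sqr sqrf_eq0; apply: contra v0 => /eqP/dsum_normr0_eq0->.
Qed.

HB.instance Definition _ := isDotProduct.Build C V dsum_dot dsum_dot_gt0.

Lemma dsum_hdot_norm (v : V) : `|v| ^+ 2 = dsum_dot v v.
Proof. by rewrite dsum_normE dsum_norm_sqr dsum_dotE. Qed.

HB.instance Definition _ := isHilbert.Build R V dsum_hdot_norm.

End DirectSum.

Section Operators.
Variable R : realType.
Local Notation C := (Cplx R).
Implicit Types X Y U H : hilbertType R.

Definition separable (T : topologicalType) : Prop :=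
  exists2 D : set T, countable D & dense D.

Definition unitary_op H1 H2 (T : H1 -> H2) : Prop :=
  [/\ linear T, forall x y, hdot (T x) (T y) = hdot x y
    & forall z, exists x, T x = z].

(* [get] returns an arbitrary value when no adjoint exists; it is the usual
   Hilbert space adjoint when [T] is linear and continuous *)
Definition adjoint U Y (T : U -> Y) (y : Y) : U :=
  get [set v | forall u, hdot (T u) y = hdot u v].

(* [F] with its removable singularity at [a] removed *)
Definition extend_at (V : normedModType C) (a : C) (F : C -> V) (z : C) : V :=
  if z == a then lim (F w @[w --> a^']) else F z.

Definition rhp : set C := [set l | 0 < 'Re l].
Definition disk : set C := [set z | `|z| < 1].

Definition mobius (a z : C) : C := (a - a^* * z) / (1 + z).
Definition mobius_inv (a m : C) : C := (a - m) / (a^* + m).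

(* The following families of operators are indexed by all of [C]; only their
   values on the relevant domain matter *)

(* complex differentiability in the operator norm *)
Definition op_derivable_at U Y (phi : C -> {linear U -> Y}) (l : C) : Prop :=
  exists2 D : {linear U -> Y}, continuous D &
    forall e : C, 0 < e -> \forall h \near (0 : C)^',
      forall u, `|h^-1 *: (phi (l + h) u - phi l u) - D u| <= e * `|u|.

Definition schur_rhp U Y (phi : C -> {linear U -> Y}) : Prop :=
  (forall l, rhp l -> op_derivable_at phi l) /\
  (forall l, rhp l -> forall u, `|phi l u| <= `|u|).

(* [ev x t] is the value at [t] of the function that the element [x] of [H]
   stands for *)
Definition is_rkhs (T : Type) (D : set T) (V H : hilbertType R) (ev : H -> T -> V)
    (K : T -> T -> V -> V) : Prop :=
  [/\ forall t, D t -> linear (ev ^~ t),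
      forall x, (forall t, D t -> ev x t = 0) -> x = 0
    & forall t v, D t -> exists k : H,
        (forall s, D s -> ev k s = K s t v) /\
        (forall x, hdot x k = hdot (ev x t) v)].

(* Functions [(mu, mu') |-> (f mu, g mu')] *)
Definition split_eval H X Y (f : H -> C -> X) (g : H -> C -> Y)
    (x : H) (m : C * C) : dsum X Y := (f x m.1, g x m.2).

End Operators.

Section PartialOperators.
Variable R : realType.
Local Notation C := (Cplx R).

Definition pfun_at (V W : pointedType) (G : set (V * W)) (v : V) : W :=
  get [set w | G (v, w)].

Definition single_valued (V W : Type) (G : set (V * W)) : Prop :=
  forall v w w', G (v, w) -> G (v, w') -> w = w'.

Definition linear_graph (V W : lmodType C) (G : set (V * W)) : Prop :=
  G (0, 0) /\ forall (a : C) p q, G p -> G q -> G (a *: p + q).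

(* (l - A)^-1 *)
Definition resolvent (X : normedModType C) (A : set (X * X)) (l : C) (x : X) : X :=
  get [set w | exists2 z, A (w, z) & l *: w - z = x].

Definition resolvent_set (X : normedModType C) (A : set (X * X)) : set C :=
  [set l | (forall x, exists! w, exists2 z, A (w, z) & l *: w - z = x) /\
           continuous (resolvent A l)].

End PartialOperators.

Section SystemNode.
Variables (R : realType) (X U Y : hilbertType R).
Local Notation C := (Cplx R).
Variable S : set (dsum X U * dsum X Y).

Definition main_op : set (X * X) :=
  [set p | exists y, S ((p.1, 0), (p.2, y))].
Definition observation_op : set (X * Y) :=
  [set p | exists z, S ((p.1, 0), (z, p.2))].
Definition AB_op : set (dsum X U * X) :=
  [set p | exists y, S (p.1, (p.2, y))].

(* By passivity the main operator is dissipative; being densely defined with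
   the right half-plane in its resolvent set, it generates a contraction
   semigroup (Lumer--Phillips). *)
Record passive_system_node : Prop := PassiveSystemNode {
  node_linear : linear_graph S;
  node_single_valued : single_valued S;
  node_closed : closed S;
  node_AB_closed : closed AB_op;
  node_input : forall u, exists x v, S ((x, u), v);
  node_dense : dense [set x | exists z, main_op (x, z)];
  node_resolvent : @rhp R `<=` resolvent_set main_op;
  node_passive : forall x u z y, S ((x, u), (z, y)) ->
    2 * 'Re (hdot z x) <= `|u| ^+ 2 - `|y| ^+ 2 }.

(* The completion [X_{-1}], the embedding of [X] into it, the extension
   [A_{-1}] of the main operator and the control operator [B]. All choices
   are isomorphic. *)
Record extrapolation := Extrapolation {
  ext_beta : C;
  ext_beta_rhp : rhp ext_beta;
  ext_space : completeNormedModType C;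
  ext_emb : {linear X -> ext_space};
  ext_norm : forall x, `|ext_emb x| = `|resolvent main_op ext_beta x|;
  ext_dense : dense (range ext_emb);
  ext_main : {linear X -> ext_space};
  ext_main_cont : continuous ext_main;
  ext_mainE : forall x z, main_op (x, z) -> ext_main x = ext_emb z;
  ext_ctrl : {linear U -> ext_space};
  ext_ctrl_cont : continuous ext_ctrl;
  ext_ABE : forall x u z, AB_op ((x, u), z) ->
    ext_emb z = ext_main x + ext_ctrl u }.

Variable E : extrapolation.

(* (l - A_{-1})^-1 B *)
Definition ext_input (l : C) (u : U) : X :=
  get [set x | l *: ext_emb E x - ext_main E x = ext_ctrl E u].

Definition transfer (l : C) (u : U) : Y :=
  (pfun_at S (ext_input l u, u)).2.

Definition cayleyA (a : C) (x : X) : X :=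
  a^* *: resolvent main_op a x + pfun_at main_op (resolvent main_op a x).
Definition cayleyB (a : C) (u : U) : X :=
  sqrtC (2 * 'Re a) *: ext_input a u.
Definition cayleyC (a : C) (x : X) : Y :=
  sqrtC (2 * 'Re a) *: pfun_at observation_op (resolvent main_op a x).
Definition cayleyD (a : C) (u : U) : Y := transfer a u.

Definition cayley (a : C) (w : dsum X U) : dsum X Y :=
  (cayleyA a w.1 + cayleyB a w.2, cayleyC a w.1 + cayleyD a w.2).

End SystemNode.

Section Models.
Variables (R : realType) (U Y : hilbertType R).
Local Notation C := (Cplx R).
Variable phi : C -> {linear U -> Y}.

Definition tilde (m : C) : Y -> U := adjoint (phi m^*).

Definition Kc (m l : C) (u : U) : U :=
  (m + l^*)^-1 *: (u - tilde m (adjoint (tilde l) u)).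

Definition Ks (m l : C * C) (v : dsum Y U) : dsum Y U :=
  let: (mu, mus) := m in let: (la, las) := l in let: (y, u) := v in
  ((mu + la^*)^-1 *: (y - phi mu (adjoint (phi la) y))
     + extend_at las^* (fun w => (w - las^*)^-1 *: (phi las^* u - phi w u)) mu,
   extend_at la^* (fun w => (w - la^*)^-1 *: (tilde la^* y - tilde w y)) mus
     + Kc mus las u).

(* Graph of the conservative model on the space [H] of the functions
   [(mu, mu') |-> (f x mu, g x mu')] *)
Definition Ss (H : hilbertType R) (f : H -> C -> Y) (g : H -> C -> U) :
    set (dsum H U * dsum H Y) :=
  [set p | let: ((x, u), (z, y)) := p in
     forall mu mus, rhp mu -> rhp mus ->
       f z mu = mu *: f x mu + phi mu u - y /\
       g z mus = - (mus *: g x mus) + u - tilde mus y].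

(* Kernel and operators of the classical model on the disk; here [phi] plays
   the role of the Schur function on the disk *)
Definition Kdisk (z w : C) (v : dsum Y U) : dsum Y U :=
  let: (y, u) := v in
  ((1 - z * w^*)^-1 *: (y - phi z (adjoint (phi w) y))
     + extend_at w^* (fun t => (t - w^*)^-1 *: (phi t u - phi w^* u)) z,
   extend_at w^* (fun t => (t - w^*)^-1 *:
       (adjoint (phi t^*) y - adjoint (phi w) y)) z
     + (1 - z * w^*)^-1 *: (u - adjoint (phi z^*) (phi w^* u))).

Definition diskA (f : C -> Y) (g : C -> U) (z : C) : dsum Y U :=
  (extend_at 0 (fun t => t^-1 *: (f t - f 0)) z,
   z *: g z - adjoint (phi z^*) (f 0)).
Definition diskB (u : U) (z : C) : dsum Y U :=
  (extend_at 0 (fun t => t^-1 *: (phi t u - phi 0 u)) z,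
   u - adjoint (phi z^*) (phi 0 u)).

Definition model_cayleyA (a : C) (h : C -> Y) (l : C -> U) (m : C * C) : dsum Y U :=
  (extend_at a (fun t => ((a^* + t) / (a - t)) *: h t
                         - (2 * 'Re a / (a - t)) *: h a) m.1,
   ((a^* - m.2) / (a + m.2)) *: l m.2
     - (2 * 'Re a / (a + m.2)) *: tilde m.2 (h a)).
Definition model_cayleyB (a : C) (u : U) (m : C * C) : dsum Y U :=
  sqrtC (2 * 'Re a) *:
    ((extend_at a (fun t => (a - t)^-1 *: (phi t u - phi a u)) m.1,
      Kc m.2 a^* u) : dsum Y U).

Definition Xi_fun (a : C) (f : C -> Y) (g : C -> U) (m : C * C) : dsum Y U :=
  sqrtC (2 * 'Re a) *:
    (((a^* + m.1)^-1 *: f (mobius_inv a m.1),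
      (a + m.2)^-1 *: g (mobius_inv a^* m.2)) : dsum Y U).

End Models.

(* Main.v *)
Require Import Defs.
From HB Require Import structures.
From mathcomp Require Import all_boot all_order all_algebra complex.
From mathcomp Require Import all_classical all_reals topology normedtype.
From mathcomp Require Import ring.
Import Order.TTheory GRing.Theory Num.Theory.
Import numFieldNormedType.Exports.
Local Open Scope classical_set_scope.
Local Open Scope ring_scope.
Set Implicit Arguments.
Unset Strict Implicit.
Unset Printing Implicit Defensive.

(* Clearing denominators, [(k, y)] is the image of [(h, u)] under the Cayley
   transform iff [(h, u)] and [(k, y)] have equal inner products with the two
   members of each pair of an explicit family of pairs built from kernel
   functions. The kernel identity says that both members of these pairs have
   the same Gram matrix, and each side of the family is total; hence the
   relation is the graph of a unitary operator [T]. The model [S_s] is the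
   inverse Cayley transform of [T], and this yields all its properties: the
   energy balance is the isometry of [T], and [(a - A)^-1] and
   [(a - A_{-1})^-1 B] are read off from [T].
   The extrapolation space may be realized as the state space itself, embedded
   by a resolvent.
   Composing the classical space on the disk with the Moebius map and
   multiplying by the weights of [Xi] gives a space with kernel [K_s]. Two
   spaces with the same kernel are unitarily equivalent, which gives [Xi], and
   the classical operators are obtained by transport. The removable
   singularities are dealt with by continuity of the elements of the spaces. *)

(** * Hilbert spaces *)

(** The kernel entries with removable singularities are given by limits whose existence is not known
    in advance, so no value is ever read off there. What breaks the circle is that the two diagonal
    entries alone already make every element of the space continuous. With denominators cleared, the
    exceptional points become useful. At m = a the first equation no longer contains the image state
    and yields the output y. At m = conj a the second equation loses its initial state and
    determines the input from the image. The extrapolation space is universally quantified, so the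
    action of (a - A_{-1})^-1 B has to be identified in an arbitrary completion; this rests on the
    injectivity of a - A_{-1}, obtained by density of the domain of A. *)

(** Stated for maps that respect subtraction because it is also applied to conjugation and to the
    real part, which are not complex linear. *)
Lemma bounded_additive_continuous (K : numFieldType) (V W : normedModType K)
    (f : V -> W) (M : K) :
  (forall x y, f (x - y) = f x - f y) -> 0 <= M ->
  (forall x, `|f x| <= M * `|x|) -> continuous f.
Proof.
move=> fB M0 fM x; apply/cvgrPdist_lt => e e0.
have M1 : 0 < M + 1 by rewrite ltr_wpDl.
near=> t; rewrite -fB (le_lt_trans (fM _))//.
apply: (@le_lt_trans _ _ ((M + 1) * `|x - t|)); first by rewrite ler_wpM2r// lerDl.
rewrite mulrC -ltr_pdivlMr//; near: t; apply: cvgr_dist_lt; rewrite ?divr_gt0//.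
Unshelve. all: by end_near. Qed.

Lemma closed_point (K : numFieldType) (V : normedModType K) (x : V) :
  closed [set x].
Proof. exact: (accessible_closed_set1 (hausdorff_accessible (@norm_hausdorff _ _))). Qed.

Section Dot.
Variables (R : realType) (H : hilbertType R).
Local Notation C := (Cplx R).
Implicit Types x y z : H.

Lemma hdotC x y : hdot x y = (hdot y x)^*.
Proof. by rewrite (hermC _ x) expr0 mul1r. Qed.

Lemma hdotDl x y z : hdot (x + y) z = hdot x z + hdot y z.
Proof. exact: linearDl. Qed.

Lemma hdotBl x y z : hdot (x - y) z = hdot x z - hdot y z.
Proof. exact: linearBl. Qed.

Lemma hdotDr x y z : hdot z (x + y) = hdot z x + hdot z y.
Proof. exact: linearDr. Qed.

Lemma hdotBr x y z : hdot z (x - y) = hdot z x - hdot z y.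
Proof. exact: linearBr. Qed.

Lemma hdotZl (a : C) x y : hdot (a *: x) y = a * hdot x y.
Proof. exact: linearZl_LR. Qed.

Lemma hdotZr (a : C) x y : hdot x (a *: y) = a^* * hdot x y.
Proof. exact: linearZr_LR. Qed.

Lemma hdot0l x : hdot 0 x = 0. Proof. exact: linear0l. Qed.
Lemma hdot0r x : hdot x 0 = 0. Proof. exact: linear0r. Qed.
Lemma hdotNl x y : hdot (- x) y = - hdot x y. Proof. exact: linearNl. Qed.
Lemma hdotNr x y : hdot x (- y) = - hdot x y. Proof. exact: linearNr. Qed.

Definition hdotE := (hdotDl, hdotDr, hdotBl, hdotBr, hdotNl, hdotNr, hdotZl, hdotZr).

Lemma hdot_eq0 x : hdot x x = 0 -> x = 0.
Proof. by rewrite -hdot_norm => /eqP; rewrite sqrf_eq0 normr_eq0 => /eqP. Qed.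

Lemma hdot_ext x y : (forall z, hdot x z = hdot y z) -> x = y.
Proof. by move=> h; apply/eqP; rewrite -subr_eq0; apply/eqP/hdot_eq0; rewrite hdotBl h subrr. Qed.

Lemma hdot_extr x y : (forall z, hdot z x = hdot z y) -> x = y.
Proof. by move=> h; apply: hdot_ext => z; rewrite hdotC h -hdotC. Qed.

(** The squared distance from [x] to the line through [y]. Its positivity is the Cauchy-Schwarz
    inequality, and it measures the gain of a step along [y] in the distance minimization below. *)
Lemma normB_sqr x y : y != 0 ->
  `|x - (hdot x y / `|y| ^+ 2) *: y| ^+ 2 = `|x| ^+ 2 - `|hdot x y| ^+ 2 / `|y| ^+ 2.
Proof.
move=> y0; rewrite !hdot_norm !hdotE (hdotC y x) normCK.
have r : (hdot y y)^* = hdot y y by rewrite -hdotC.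
have n : hdot y y != 0 by rewrite -hdot_norm sqrf_eq0 normr_eq0.
by rewrite fmorph_div/= r; field.
Qed.

Lemma cauchy_schwarz x y : `|hdot x y| <= `|x| * `|y|.
Proof.
have [->|y0] := eqVneq y 0; first by rewrite hdot0r normr0 mulr_ge0.
rewrite -(@ler_pXn2r _ 2) ?nnegrE ?mulr_ge0// exprMn.
have : 0 <= `|x - (hdot x y / `|y| ^+ 2) *: y| ^+ 2 by rewrite exprn_ge0.
rewrite (normB_sqr x y0) subr_ge0 ler_pdivrMr// exprn_gt0 ?normr_gt0//.
Qed.

Lemma parallelogram x y :
  `|x - y| ^+ 2 = 2 * `|x| ^+ 2 + 2 * `|y| ^+ 2 - `|x + y| ^+ 2.
Proof. by rewrite !hdot_norm !hdotE; ring. Qed.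

Lemma hdot_contl y : continuous (fun x => hdot x y : C^o).
Proof.
apply: (@bounded_additive_continuous _ _ C^o _ `|y|) => [x t||x].
- exact: hdotBl.
- exact: normr_ge0.
- by rewrite mulrC; exact: cauchy_schwarz.
Qed.

End Dot.

(** Norms live in the partially ordered field [Cplx R]. Nonnegative elements are real, so the
    infimum can be taken in [R]. *)
Lemma cplx_inf (R : realType) (A : set (Cplx R)) :
  A !=set0 -> (forall a, A a -> 0 <= a) ->
  exists d : Cplx R, (forall a, A a -> d <= a) /\
    forall e, 0 < e -> exists2 a, A a & a < d + e.
Proof.
move=> [a0 Aa0] A0.
have realE (b : Cplx R) : 0 <= b -> b = (complex.Re b)%:C%C.
  case: b => x y; rewrite lecE /= => /andP[/eqP-> _].
  by [].
pose B := [set x : R | A (x%:C)%C].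
have ReB (a : Cplx R) : A a -> B (complex.Re a).
  by move=> Aa; rewrite /B /= -realE ?A0.
have Bi : has_inf B.
  split; first by exists (complex.Re a0); apply: ReB.
  by exists 0 => x /A0; rewrite -[0]/((0 : R)%:C)%C lecR.
exists ((inf B)%:C)%C; split=> [a Aa|e e0].
  by rewrite [a]realE ?A0// lecR; apply: ge_inf (ReB _ Aa); case: Bi.
rewrite [e]realE ?ltW//.
have re0 : 0 < complex.Re e.
  by move: e0; rewrite ltcE => /andP[_].
have [x Bx xe] := inf_adherent re0 Bi.
exists (x%:C)%C => //.
by rewrite -[_ + _]/((inf B)%:C%C + (complex.Re e)%:C%C : R[i]) -rmorphD ltcR.
Qed.

(** * Projection onto closed subspaces and density *)

Section Projection.
Variables (R : realType) (H : hilbertType R).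
Local Notation C := (Cplx R).
Implicit Types (x y z : H) (M : set H).

Definition subspace M := M 0 /\ forall (a : C) x y, M x -> M y -> M (a *: x + y).

Lemma subspaceD M x y : subspace M -> M x -> M y -> M (x + y).
Proof. by move=> [_ h] ? ?; rewrite -[x]scale1r; apply: h. Qed.

Lemma subspaceZ M a x : subspace M -> M x -> M (a *: x).
Proof. by move=> [h0 h] ?; rewrite -[_ *: _]addr0; apply: h. Qed.

(** The sets [F e] of near-minimizers of the distance to [x] generate a filter, which is Cauchy by
    the parallelogram law; [p] is its limit. *)
Lemma closed_subspace_decomp M x : subspace M -> closed M ->
  exists2 p, M p & forall m, M m -> hdot m (x - p) = 0.
Proof.
move=> sM cM.
have [||d [dM Md]] := @cplx_inf R [set `|x - m| ^+ 2 | m in M].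
- by exists (`|x - 0| ^+ 2), 0 => //; case: sM.
- by move=> _ [m _ <-]; rewrite exprn_ge0.
pose F (e : C) : set H := [set m | M m /\ `|x - m| ^+ 2 < d + e].
have F0 e : 0 < e -> F e !=set0.
  by move=> /Md[_ [m Mm <-]] h; exists m.
have Fdist e m n : F e m -> F e n -> `|m - n| ^+ 2 <= 4 * e.
  move=> [Mm hm] [Mn hn].
  have -> : m - n = (x - n) - (x - m) by rewrite opprB [RHS]addrC addrA subrK.
  rewrite parallelogram.
  have -> : x - n + (x - m) = 2 *: (x - 2^-1 *: (m + n)).
    rewrite scalerBr scalerA divff ?pnatr_eq0// scale1r scaler_nat mulr2n.
    by rewrite opprD addrACA [- m - n]addrC.
  rewrite normrZ exprMn ger0_norm//.
  have := dM _ (ex_intro2 _ _ (2^-1 *: (m + n)) (subspaceZ _ sM (subspaceD sM Mm Mn)) erefl).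
  set r := `|x - 2^-1 *: _| ^+ 2 => dr.
  have -> : 4 * e = 2 * (d + e) + 2 * (d + e) - 2 ^+ 2 * d by ring.
  by apply: lerB; [apply: lerD|]; rewrite ler_wpM2l ?exprn_ge0// ltW.
have FF : ProperFilter (filter_from [set e : C | 0 < e] F).
  apply: filter_from_proper; last by move=> e /=; apply: F0.
  apply: filter_from_filter; first by exists 1 => /=.
  move=> i j /= i0 j0.
  have mono e e' : e <= e' -> F e `<=` F e'.
    by move=> ee' m [Mm h]; split=> //; apply: lt_le_trans h _; rewrite lerD2l.
  have /orP[ij|ji] : (i <= j) || (j <= i) by apply: real_comparable; apply: gtr0_real.
  - by exists i => // m Fm; split=> //; apply: mono Fm.
  - by exists j => // m Fm; split=> //; apply: mono Fm.
have Fc : cauchy (filter_from [set e : C | 0 < e] F).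
  apply: cauchy_exP => e e0.
  have e1 : 0 < e ^+ 2 / 8 by rewrite divr_gt0 ?exprn_gt0.
  have [m Fm] := F0 _ e1; exists m, (e ^+ 2 / 8) => // n Fn.
  rewrite -ball_normE/= -(@ltr_pXn2r _ 2) ?nnegrE ?normr_ge0 ?(ltW e0)//.
  apply: le_lt_trans (Fdist _ _ _ Fm Fn) _.
  rewrite -subr_gt0; have -> : e ^+ 2 - 4 * (e ^+ 2 / 8) = e ^+ 2 / 2 by field.
  by rewrite divr_gt0// exprn_gt0.
have /cvg_ex[p Fp] : cvg (filter_from [set e : C | 0 < e] F) by exact: cauchy_cvg.
have Fin e : 0 < e -> filter_from [set e : C | 0 < e] F (F e) by move=> e0; exists e.
exists p.
  apply: cM => B nB; have [m [[Mm _] Bm]] := filter_ex (filterI (Fin _ ltr01) (Fp _ nB)).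
  by exists m.
move=> m Mm; have [->|m0] := eqVneq m 0; first by rewrite hdot0l.
have m2 : 0 < `|m| ^+ 2 by rewrite exprn_gt0 ?normr_gt0.
rewrite hdotC.
suff -> : hdot (x - p) m = 0 by rewrite conjC0.
set g := hdot (x - p) m.
(* Split x - p as (x - n) + (n - p) with n in [F (e ^+ 2)] and |n - p| < e. A step from n along m
   lowers the squared distance by |<x - n, m>|^2 / |m|^2, which is at most e^2 because d is a lower
   bound. The other summand is handled by Cauchy-Schwarz. *)
have gle e : 0 < e -> `|g| <= 2 * e * `|m|.
  move=> e0; rewrite -(@ler_pXn2r _ 2) ?nnegrE ?mulr_ge0 ?normr_ge0 ?(ltW e0)// !exprMn.
  have e2 : 0 < e ^+ 2 by rewrite exprn_gt0.
  have /filter_ex[n [[Mn hn] pn]] : (filter_from [set e : C | 0 < e] F) (F (e ^+ 2) `&` ball p e).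
    by apply: filterI; [exact: Fin | apply: Fp; exact: nbhsx_ballx].
  have h1 : `|hdot (x - n) m| ^+ 2 <= e ^+ 2 * `|m| ^+ 2.
    rewrite -ler_pdivrMr//.
    have := dM _ (ex_intro2 _ _ (n + (hdot (x - n) m / `|m| ^+ 2) *: m)
      (subspaceD sM Mn (subspaceZ _ sM Mm)) erefl).
    rewrite opprD addrA (normB_sqr (x - n) m0) lerBrDr => h.
    by have := le_lt_trans h hn; rewrite ltrD2l => /ltW.
  have h2 : `|hdot (n - p) m| ^+ 2 <= e ^+ 2 * `|m| ^+ 2.
    rewrite -exprMn ler_pXn2r ?nnegrE ?mulr_ge0 ?normr_ge0 ?(ltW e0)//.
    apply: le_trans (cauchy_schwarz _ _) _; rewrite ler_wpM2r//.
    by move: pn; rewrite -ball_normE/= distrC => /ltW.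
  have -> : g = hdot (x - n) m + hdot (n - p) m by rewrite -hdotDl addrA subrK.
  set a := hdot (x - n) m in h1 *; set b := hdot (n - p) m in h2 *.
  apply: (@le_trans _ _ (2 * `|a| ^+ 2 + 2 * `|b| ^+ 2)).
    rewrite -subr_ge0 !normCK rmorphD/=.
    have -> : 2 * (a * a^*) + 2 * (b * b^*) - (a + b) * (a^* + b^*) =
      (a - b) * (a - b)^* by rewrite rmorphB/=; ring.
    by rewrite -normCK exprn_ge0.
  have -> : 2 ^+ 2 * e ^+ 2 * `|m| ^+ 2 =
      2 * (e ^+ 2 * `|m| ^+ 2) + 2 * (e ^+ 2 * `|m| ^+ 2) by ring.
  by rewrite lerD// ler_wpM2l.
apply/eqP/negPn/negP => g0.
have g1 : 0 < `|g| by rewrite normr_gt0.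
have m1 : 0 < `|m| by rewrite normr_gt0.
have := gle (`|g| / (4 * `|m|)) (divr_gt0 g1 (mulr_gt0 (ltr0Sn _ 3) m1)).
have -> : 2 * (`|g| / (4 * `|m|)) * `|m| = `|g| / 2 by field; rewrite lt0r_neq0.
by rewrite ler_pdivlMr// ger_pMr// lern1.
Qed.

(** The closure is again a subspace; the residual of [x] against it is orthogonal to [M], hence
    zero. *)
Lemma dense_subspace M : subspace M ->
  (forall x, (forall m, M m -> hdot m x = 0) -> x = 0) -> dense M.
Proof.
move=> sM h; suff cM x : closure M x.
  move=> O [x Ox] oO; have [y []] := cM x O (open_nbhs_nbhs (conj oO Ox)).
  by move=> My Oy; exists y.
have sc : subspace (closure M).
  split=> [|a y z cy cz]; first by apply: subset_closure; case: sM.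
  move=> B nB.
  have : (fun t : H * H => a *: t.1 + t.2) @ (y, z) --> a *: y + z.
    by apply: cvgD; [apply: cvgZl_tmp; exact: cvg_fst | exact: cvg_snd].
  move=> /(_ _ nB) [[P Q] /= [nP nQ] PQ].
  have [p [Mp Pp]] := cy _ nP; have [q [Mq Qq]] := cz _ nQ.
  exists (a *: p + q); split; last exact: (PQ (p, q)).
  by case: sM => _; apply.
have [p cp hp] := closed_subspace_decomp x sc (@closed_closure _ M).
suff -> : x = p by [].
by apply/eqP; rewrite -subr_eq0; apply/eqP/h => m Mm; apply/hp/subset_closure.
Qed.

Lemma subspace_annihilator (S : set H) :
  subspace [set x | forall s, S s -> hdot x s = 0].
Proof.
split=> [s _|a x y hx hy s Ss]; first by rewrite hdot0l.
by rewrite !hdotE hx// hy// mulr0 addr0.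
Qed.

Lemma closed_annihilator (S : set H) :
  closed [set x | forall s, S s -> hdot x s = 0].
Proof.
have -> : [set x | forall s, S s -> hdot x s = 0] =
    \bigcap_(s in S) (fun x => hdot x s : C^o) @^-1` [set 0].
  by apply/seteqP; split=> x.
apply: closed_bigI => s _; apply: closed_comp; last exact: (@closed_point C C^o).
by move=> x _; exact: hdot_contl.
Qed.

End Projection.

Section Riesz.
Variables (R : realType) (H : hilbertType R).
Local Notation C := (Cplx R).

Lemma riesz (l : H -> C) : (forall a x y, l (a *: x + y) = a * l x + l y) ->
  (exists2 M : C, 0 <= M & forall x, `|l x| <= M * `|x|) ->
  exists v, forall x, l x = hdot x v.
Proof.
move=> lin [M M0 lM].
have l0 : l 0 = 0 by have := lin (-1) 0 0; rewrite scaler0 addr0 mulN1r addNr.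
have sK : subspace [set x | l x = 0].
  by split=> [//|a x y /= lx ly]; rewrite lin lx ly mulr0 addr0.
have lB x y : l (x - y) = l x - l y.
  by rewrite addrC -scaleN1r lin mulN1r addrC.
have lc : continuous l.
  by apply: bounded_additive_continuous lM.
have cK : closed [set x | l x = 0].
  by apply: (@closed_comp _ _ l [set 0]) => [x _|]; [exact: lc | exact: (@closed_point C C^o)].
have [[x lx]|/forallNP nx] := pselect (exists x, l x <> 0); last first.
  by exists 0 => x; rewrite hdot0r; apply/not_notP/nx.
have [p lp hp] := closed_subspace_decomp x sK cK.
set q := x - p in hp.
have lq : l q <> 0 by rewrite lB lp subr0.
have q0 : q != 0 by apply: contra_notN lq => /eqP ->.
exists (((l q)^* / `|q| ^+ 2) *: q) => y.
have : hdot (y - (l y / l q) *: q) q = 0.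
  apply: hp => /=; rewrite addrC -scaleN1r scalerA lin mulN1r mulNr mulfVK ?addNr//.
  exact/eqP.
have qq : hdot q q != 0 by rewrite -hdot_norm sqrf_eq0 normr_eq0.
rewrite hdotBl hdotZl hdotZr => /subr0_eq ->.
rewrite fmorph_div/= conjCK hdot_norm -hdotC; field.
by apply/andP; split; [exact/eqP | exact: qq].
Qed.

End Riesz.

Section Adjoint.
Variables (R : realType) (U Y : hilbertType R) (T : {linear U -> Y}).
Local Notation C := (Cplx R).
Hypothesis T_contr : forall u, `|T u| <= `|u|.

Lemma adjointP u y : hdot (T u) y = hdot u (adjoint T y).
Proof.
suff : exists v, forall u, hdot (T u) y = hdot u v.
  by case=> v hv; rewrite /adjoint; case: xgetP => [w _ ->//|/(_ v)/(_ hv)].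
apply: riesz => [a x z|]; first by rewrite linearP !hdotE.
exists `|y| => // x; apply: le_trans (cauchy_schwarz _ _) _.
by rewrite mulrC ler_wpM2l.
Qed.

Lemma adjointP' u y : hdot (adjoint T y) u = hdot y (T u).
Proof. by rewrite hdotC -adjointP -hdotC. Qed.

Lemma adjoint_linear : linear (adjoint T).
Proof.
move=> a x y; apply: hdot_extr => u.
by rewrite -adjointP !hdotE !adjointP.
Qed.

Lemma adjoint_contr y : `|adjoint T y| <= `|y|.
Proof.
have [->|v0] := eqVneq (adjoint T y) 0; first by rewrite normr0.
have v1 : 0 < `|adjoint T y| by rewrite normr_gt0.
rewrite -(@ler_pM2l _ _ v1) -expr2 hdot_norm -adjointP.
have h : 0 <= hdot (T (adjoint T y)) y by rewrite adjointP -hdot_norm exprn_ge0.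
rewrite -[X in X <= _]ger0_norm//; apply: le_trans (cauchy_schwarz _ _) _.
by rewrite ler_wpM2r.
Qed.

Lemma adjointK u : adjoint (adjoint T) u = T u.
Proof.
rewrite /adjoint; case: xgetP => [w _ hw|/(_ (T u))[y]]; last exact: adjointP'.
by apply: hdot_extr => y; rewrite -hw -/(adjoint T y) adjointP'.
Qed.

End Adjoint.

(** Serves also at parameters outside the half-plane, where [phi] is arbitrary: zero is always an
    admissible value, so [get] does not default. *)
Lemma adjoint0 (R : realType) (U Y : hilbertType R) (T : {linear U -> Y}) :
  adjoint T 0 = 0.
Proof.
rewrite /adjoint; case: xgetP => [w _ hw|/(_ 0)[u]]; last by rewrite !hdot0r.
by apply: hdot_eq0; rewrite -hw hdot0r.
Qed.

Lemma dsum_hdotE (R : realType) (X U : hilbertType R) (v w : dsum X U) :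
  hdot v w = hdot v.1 w.1 + hdot v.2 w.2.
Proof. by []. Qed.

(** * Unitary operators from equal Gram matrices *)

Section Unitary.
Variable R : realType.
Local Notation C := (Cplx R).
Implicit Types H : hilbertType R.

Lemma unitary_comp H1 H2 H3 (S : H2 -> H3) (T : H1 -> H2) :
  unitary_op S -> unitary_op T -> unitary_op (S \o T).
Proof.
move=> [lS iS sS] [lT iT sT]; split=> [a x y|x y|z] /=.
- by rewrite lT lS.
- by rewrite iS iT.
- by have [y <-] := sS z; have [x <-] := sT y; exists x.
Qed.

Lemma unitary_norm H1 H2 (T : H1 -> H2) x : unitary_op T -> `|T x| = `|x|.
Proof.
move=> [_ iT _]; apply/eqP; rewrite -(@eqrXn2 _ 2)//.
by rewrite !hdot_norm iT.
Qed.

Lemma unitary0 H1 H2 (T : H1 -> H2) : unitary_op T -> T 0 = 0.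
Proof. by move=> /unitary_norm h; apply/eqP; rewrite -normr_eq0 h normr0. Qed.

Lemma unitary_inj H1 H2 (T : H1 -> H2) : unitary_op T -> injective T.
Proof.
move=> uT x y Txy; apply/eqP; rewrite -subr_eq0 -normr_eq0 -(unitary_norm _ uT).
case: uT => lT _ _.
by rewrite addrC -scaleN1r lT Txy scaleN1r addNr normr0.
Qed.

Lemma unitary_inv H1 H2 (T : H1 -> H2) : unitary_op T ->
  exists S : H2 -> H1, [/\ unitary_op S, cancel S T & cancel T S].
Proof.
move=> uT; have injT := unitary_inj uT; case: (uT) => lT iT /choice[S TS].
have ST : cancel T S by move=> x; apply: injT; rewrite TS.
exists S; split=> //; split=> [a x y|x y|x].
- by apply: injT; rewrite lT !TS.
- by rewrite -iT !TS.
- by exists (T x); rewrite ST.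
Qed.

(* In the space [H1 (+) H2] with the indefinite form [<x, x'> - <y, y'>] the
   pairs of [S] span a neutral subspace; the graph of the unitary operator is
   its orthogonal companion. *)
Lemma unitary_of_pairs H1 H2 (S : set (H1 * H2)) :
  (forall p q, S p -> S q -> hdot p.1 q.1 = hdot p.2 q.2) ->
  (forall x, (forall p, S p -> hdot x p.1 = 0) -> x = 0) ->
  (forall y, (forall p, S p -> hdot y p.2 = 0) -> y = 0) ->
  exists2 T : H1 -> H2, unitary_op T &
    forall x y, (forall p, S p -> hdot x p.1 = hdot y p.2) <-> y = T x.
Proof.
(* Totality of the first members yields an isometry [T]. Applied to the transposed family, the same
   statement yields [V], which provides the preimages. *)
have half H3 H4 (P : set (H3 * H4)) :
    (forall p q, P p -> P q -> hdot p.1 q.1 = hdot p.2 q.2) ->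
    (forall x, (forall p, P p -> hdot x p.1 = 0) -> x = 0) ->
    exists2 T : H3 -> H4, forall x p, P p -> hdot x p.1 = hdot (T x) p.2 &
      forall x x', hdot (T x) (T x') = hdot x x'.
  move=> gram tot.
  pose N : set (dsum H3 H4) := [set w | forall p, P p -> hdot w.1 p.1 + hdot w.2 p.2 = 0].
  pose M : set (dsum H3 H4) := [set w | forall n, N n -> hdot w n = 0].
  have neutral p : P p -> N (p.1, - p.2).
    by move=> Pp q Pq /=; rewrite hdotNl (gram _ _ Pp Pq) subrr.
  (* [M] is the closed span of the pairs. Let (a, b) be the projection of (x, 0) onto it. Neutrality
     gives <a, p.1> = <b, p.2>, and orthogonality of the residual gives <x - a, p.1> = <b, p.2>.
     Totality forces x = 2a, whence y = 2b. *)
  have ex x : exists y, (forall p, P p -> hdot x p.1 = hdot y p.2) /\ M (x, y).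
    have [[a b] Mab hm] := closed_subspace_decomp ((x, 0) : dsum H3 H4)
      (subspace_annihilator N) (@closed_annihilator _ _ N).
    have hd p : P p -> hdot a p.1 = hdot b p.2.
      move=> /neutral/Mab; rewrite dsum_hdotE/= hdotNr => /subr0_eq//.
    have hx p : P p -> hdot (x - a) p.1 = hdot b p.2.
      move=> Pp; have MP : M (p : dsum H3 H4).
        by move=> n Nn; rewrite hdotC dsum_hdotE Nn// conjC0.
      have := hm _ MP; rewrite dsum_hdotE/= sub0r hdotNr => /subr0_eq h.
      by rewrite hdotC h -hdotC.
    have xa : x = 2 *: a.
      apply/eqP; rewrite -subr_eq0; apply/eqP/tot => p Pp.
      rewrite hdotBl hdotZl hd//.
      have := hx _ Pp; rewrite hdotBl hd// => /eqP; rewrite subr_eq => /eqP->.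
      by ring.
    exists (2 *: b); split=> [p Pp|].
      by rewrite xa !hdotZl hd.
    rewrite xa; exact: (subspaceZ 2 (subspace_annihilator N) Mab).
  have [T hT] := choice ex.
  exists T => [x p|x x']; first by have [h _] := hT x; apply: h.
  (* (x, T x) lies in [M] and (x', - T x') in [N]; that they are orthogonal is the isometry. *)
  have [_ Mx] := hT x; have [Px' _] := hT x'.
  have : N (x', - T x').
    by move=> p Pp /=; rewrite hdotNl Px'// subrr.
  by move=> /Mx; rewrite dsum_hdotE/= hdotNr => /subr0_eq.
move=> gram tot1 tot2.
have [T hT iT] := half _ _ S gram tot1.
have [V hV iV] : exists2 T : H2 -> H1, forall y p, S p -> hdot y p.2 = hdot (T y) p.1 &
      forall x x', hdot (T x) (T x') = hdot x x'.
  have [|//|V hV iV] := half _ _ [set p : H2 * H1 | S (p.2, p.1)].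
  - by move=> [p1 p2] [q1 q2] /= Sp Sq; rewrite -(gram _ _ Sp Sq).
  - by move=> y hy; apply: tot2 => -[p1 p2] Sp; exact: (hy (p2, p1)).
  - by exists V => // y [p1 p2] Sp; exact: (hV y (p2, p1)).
have uniq x y : (forall p, S p -> hdot x p.1 = hdot y p.2) -> y = T x.
  move=> h; apply/eqP; rewrite -subr_eq0; apply/eqP/tot2 => p Sp.
  by rewrite hdotBl -h// -hT// subrr.
exists T; last by move=> x y; split=> [|-> p]; [exact: uniq | exact: hT].
split=> // [a x y|z].
  by apply/esym/uniq => p Sp; rewrite !hdotE !hT.
by exists (V z); apply/esym/uniq => p Sp; rewrite hV.
Qed.

End Unitary.

(** * Reproducing kernels on the half-plane *)

Section HalfPlane.
Variable R : realType.
Local Notation C := (Cplx R).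
Implicit Types a l m : C.

Lemma twice_Re a : 2 * 'Re a = a + a^*.
Proof. by rewrite ReE; field. Qed.

Lemma rhp_conj l : rhp l -> rhp l^*.
Proof. by rewrite /rhp /= Re_conj. Qed.

Lemma rhp_addC_gt0 l : rhp l -> 0 < l + l^*.
Proof. by move=> h; rewrite -twice_Re mulr_gt0. Qed.

Lemma rhp_add_neq0 l m : rhp l -> rhp m -> l + m != 0.
Proof.
move=> hl hm; apply/eqP => lm; have : 0 < 'Re (l + m) by rewrite raddfD addr_gt0.
by rewrite lm raddf0 ltxx.
Qed.

Lemma rhp1 : rhp (1 : C).
Proof. by rewrite /rhp/= (Creal_ReP _ _) ?real1. Qed.

Lemma conjC_continuous : continuous (fun z : C => z^* : C).
Proof.
apply: (@bounded_additive_continuous C C^o C^o _ 1) => [x y||x].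
- by rewrite rmorphB.
- exact: ler01.
- by rewrite mul1r norm_conjC.
Qed.

Lemma near_rhp l : rhp l -> \forall m \near l, rhp m.
Proof.
move=> hl.
have : (fun z : C => 'Re z : C^o) @ l --> ('Re l : C^o).
  apply: (@bounded_additive_continuous C C^o C^o _ 1) => [x y||x].
  - by rewrite raddfB.
  - exact: ler01.
  - by rewrite mul1r; case: (leif_normC_Re_Creal x).
move=> /cvgrPdist_lt/(_ _ hl); apply: filterS => m.
have rl := Creal_Re l; have rm := Creal_Re m.
rewrite real_ltr_norml ?realB// => /andP[_].
by rewrite ltrBlDr ltrDl.
Qed.

Lemma cvg_punctured (V : normedModType C) (F : C -> V) a (y : V) :
  F w @[w --> a] --> y -> F w @[w --> a^'] --> y.
Proof. by move=> Fy; apply: cvg_trans Fy; apply: cvg_app; exact: cvg_within. Qed.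

Lemma continuous_agree (V : normedModType C) (F G : C -> V) a (y z : V) :
  (\forall w \near a^', F w = G w) ->
  F w @[w --> a] --> y -> G w @[w --> a] --> z -> y = z.
Proof.
move=> FG Fy Gz; apply: (@cvg_unique _ (@norm_hausdorff _ V) (F w @[w --> a^'])).
  exact: cvg_punctured.
apply: cvg_trans (cvg_punctured Gz).
by move=> N /= GN; apply: filterS2 FG GN => w /= ->.
Qed.

Lemma extend_at_neq (V : normedModType C) a (F : C -> V) z : z != a ->
  extend_at a F z = F z.
Proof. by rewrite /extend_at => /negbTE->. Qed.

Lemma extend_at_lim (V : normedModType C) a (F G : C -> V) :
  (\forall w \near a^', F w = G w) -> G w @[w --> a] --> G a ->
  extend_at a F a = G a.
Proof.
move=> FG Gc; rewrite /extend_at eqxx.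
apply: cvg_lim; first exact: norm_hausdorff.
apply: cvg_trans (cvg_punctured Gc).
by move=> N /= GN; apply: filterS2 FG GN => w /= ->.
Qed.

End HalfPlane.

(** * Continuity of functions in a space with kernel [q s' s (1 - P s' Q s)] *)

Section KernelContinuity.
Variables (R : realType) (H V W : hilbertType R).
Local Notation C := (Cplx R).
Variables (D : set C) (f : H -> C -> V) (q : C -> C -> C).
Variables (P : C -> W -> V) (Q : C -> V -> W).
Hypothesis kernel : forall s v, D s -> exists2 k : H,
  forall s', D s' -> f k s' = q s' s *: (v - P s' (Q s v)) &
  forall x, hdot x k = hdot (f x s) v.
Hypothesis P_contr : forall s, D s -> forall w, `|P s w| <= `|w|.
Hypothesis Q_contr : forall s, D s -> forall v, `|Q s v| <= `|v|.

(* Only differences of the kernel in its first argument occur: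
   [|k_s - k_t|^2 = <(K(s,s) - K(t,s)) v, v> - <(K(s,t) - K(t,t)) v, v>]. *)
Lemma kernel_dist_le x s t (e B : C) : D s -> D t -> 0 <= e -> 0 <= B ->
  `|q s s - q t s| <= e -> `|q s t - q t t| <= e ->
  `|q t s| <= B -> `|q s t| <= B ->
  (forall w, `|P s w - P t w| <= e * `|w|) ->
  `|f x s - f x t| ^+ 2 <= `|x| ^+ 2 * ((4 + 2 * B) * e).
Proof.
move=> Ds Dt e0 B0 h1 h2 b1 b2 hP.
(* Testing with the increment itself gives |v|^2 = <x, ks - kt>, while [part] bounds |ks - kt|^2 by
   a multiple of |v|^2. Squaring the first and cancelling |v|^2 leaves the claim. *)
have [v vdef] : exists v, v = f x s - f x t by eexists.
rewrite -vdef.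
have [ks ksE ksx] := kernel v Ds; have [kt ktE ktx] := kernel v Dt.
have part (a b : C) r w : D r -> D w -> `|a| <= e -> `|b| <= B ->
    `|a *: (v - P r (Q w v)) - b *: (P s (Q w v) - P t (Q w v))| <= (2 + B) * e * `|v|.
  move=> Dr Dw ae bB; have Qv := Q_contr Dw v.
  apply: le_trans (ler_normB _ _) _; rewrite !normrZ.
  have -> : (2 + B) * e * `|v| = e * (2 * `|v|) + B * (e * `|v|) by ring.
  apply: lerD; apply: ler_pM => //.
    apply: le_trans (ler_normB _ _) _.
    by rewrite mulr_natl mulr2n lerD2l (le_trans (P_contr Dr _)).
  by apply: le_trans (hP _) _; rewrite ler_wpM2l.
have [v0|v0] := eqVneq v 0.
  rewrite v0 normr0 expr0n/=; apply: mulr_ge0; first by rewrite exprn_ge0.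
  by apply: mulr_ge0 => //; rewrite addr_ge0// mulr_ge0.
have v2 : 0 < `|v| ^+ 2 by rewrite exprn_gt0// normr_gt0.
have vE : `|v| ^+ 2 = hdot x (ks - kt).
  by rewrite hdotBr ksx ktx -hdotBl -vdef hdot_norm.
rewrite -(ler_pM2r v2).
have -> : `|v| ^+ 2 * `|v| ^+ 2 = `|hdot x (ks - kt)| ^+ 2.
  by rewrite -vE ger0_norm ?exprn_ge0// -expr2.
apply: (@le_trans _ _ ((`|x| * `|ks - kt|) ^+ 2)).
  by rewrite ler_pXn2r ?nnegrE ?mulr_ge0// cauchy_schwarz.
rewrite exprMn -[X in _ <= X]mulrA; apply: ler_wpM2l; first by rewrite exprn_ge0.
have kE : `|ks - kt| ^+ 2 =
    hdot (f ks s - f ks t) v - hdot (f kt s - f kt t) v.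
  by rewrite hdot_norm hdotBl !hdotBr !ksx !ktx !hdotBl.
have n0 : 0 <= `|ks - kt| ^+ 2 by rewrite exprn_ge0.
rewrite -[X in X <= _]ger0_norm// kE.
apply: le_trans (ler_normB _ _) _.
have -> : (4 + 2 * B) * e * `|v| ^+ 2 =
  (2 + B) * e * `|v| * `|v| + (2 + B) * e * `|v| * `|v| by ring.
have ds : f ks s - f ks t = (q s s - q t s) *: (v - P s (Q s v)) -
    q t s *: (P s (Q s v) - P t (Q s v)).
  by rewrite !ksE//; apply: hdot_ext => z; rewrite !hdotE; ring.
have dt : f kt s - f kt t = (q s t - q t t) *: (v - P t (Q t v)) -
    q s t *: (P s (Q t v) - P t (Q t v)).
  by rewrite !ktE//; apply: hdot_ext => z; rewrite !hdotE; ring.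
by apply: lerD; apply: le_trans (cauchy_schwarz _ _) _; rewrite ler_wpM2r// ?ds ?dt part.
Qed.

Lemma kernel_continuous x t : D t -> (\forall s \near t, D s) ->
  q s s - q t s @[s --> t] --> (0 : C^o) -> q s t - q t t @[s --> t] --> (0 : C^o) ->
  q t s @[s --> t] --> (q t t : C^o) ->
  (forall e, 0 < e -> \forall s \near t, forall w, `|P s w - P t w| <= e * `|w|) ->
  f x s @[s --> t] --> f x t.
Proof.
move=> Dt nD q1 q2 q3 hP; apply/(@cvgrPdist_lt C V C (nbhs t)) => e e0.
pose B := `|q t t| + 1.
have B0 : 0 < B by rewrite ltr_wpDl.
(* With this [d] the bound of [kernel_dist_le] is at most e^2 / 2; the summand 1 keeps the
   denominator positive when x = 0. The summand 1 in [B] makes it a bound for [q] at (t, s) and (s,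
   t) for s near t. *)
pose d := e ^+ 2 / (2 * ((`|x| ^+ 2 + 1) * (4 + 2 * B))).
have x0 : 0 < `|x| ^+ 2 + 1 by rewrite ltr_wpDl// exprn_ge0.
have B4 : 0 < 4 + 2 * B by rewrite addr_gt0// mulr_gt0.
have d0 : 0 < d by rewrite divr_gt0 ?exprn_gt0// !mulr_gt0.
near=> s; have Ds : D s by near: s.
have : `|f x s - f x t| ^+ 2 <= `|x| ^+ 2 * ((4 + 2 * B) * d).
  apply: kernel_dist_le => //; first exact: ltW; first exact: ltW.
  - by near: s; exact: (@cvgr0_norm_le C C^o _ _ _ _ q1).
  - by near: s; exact: (@cvgr0_norm_le C C^o _ _ _ _ q2).
  - by near: s; apply: (@cvgr_norm_le C C^o _ _ _ _ _ q3); rewrite /B ltrDl.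
  - have -> : q s t = (q s t - q t t) + q t t by rewrite subrK.
    apply: le_trans (ler_normD _ _) _; rewrite /B addrC lerD2l.
    by near: s; apply: (@cvgr0_norm_le C C^o _ _ _ _ q2); exact: ltr01.
  - by near: s; apply: hP.
move=> h; rewrite -(@ltr_pXn2r _ 2) ?nnegrE// ?(ltW e0)// distrC.
apply: le_lt_trans h _.
apply: (@le_lt_trans _ _ (e ^+ 2 / 2)); last first.
  by rewrite ltr_pdivrMr// ltr_pMr ?exprn_gt0// ltr1n.
have -> : e ^+ 2 / 2 = (`|x| ^+ 2 + 1) * ((4 + 2 * B) * d).
  by rewrite /d; field; rewrite !lt0r_neq0.
by rewrite ler_wpM2r ?lerDl// mulr_ge0 ?ltW.
Unshelve. all: by end_near. Qed.

End KernelContinuity.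

Section SchurContinuity.
Variables (R : realType) (U Y : hilbertType R).
Local Notation C := (Cplx R).
Variable phi : C -> {linear U -> Y}.

Lemma op_derivable_continuous l : op_derivable_at phi l ->
  forall e, 0 < e -> \forall m \near l, forall u, `|phi m u - phi l u| <= e * `|u|.
Proof.
move=> [D Dc hD] e e0.
have /linear_boundedP[M [Mr hM]] : bounded_near D (nbhs (0 : U)).
  exact: continuous_linear_bounded (Dc 0).
have {hM} DM u : `|D u| <= (`|M| + 1) * `|u|.
  by apply: hM; rewrite (le_lt_trans (real_ler_norm Mr))// ltrDl.
have /(@nbhs_ballP C C)[r /= r0 hr] := hD 1 ltr01.
pose B := 1 + (`|M| + 1).
have B0 : 0 < B by rewrite /B addr_gt0// ltr_wpDl.
have eB : 0 < e / B by rewrite divr_gt0.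
have : \forall m \near l, ball l r m /\ ball l (e / B) m.
  by apply: filterI; apply: nbhsx_ballx.
apply: filterS => m; rewrite -!ball_normE/= => -[mr me] u.
have [->|ml] := eqVneq m l; first by rewrite subrr normr0 mulr_ge0// ltW.
have ml0 : m - l != 0 by rewrite subr_eq0.
have := hr (m - l); rewrite -ball_normE/= sub0r opprB => /(_ mr ml0 u).
rewrite subrKC mul1r => h.
have -> : phi m u - phi l u =
    (m - l) *: (((m - l)^-1 *: (phi m u - phi l u) - D u) + D u).
  by rewrite subrK scalerA divff// scale1r.
rewrite normrZ distrC; apply: (@le_trans _ _ ((e / B) * (B * `|u|))).
  apply: ler_pM => //; first exact: ltW.
  by apply: le_trans (ler_normD _ _) _; rewrite /B [in leRHS]mulrDl mul1r lerD.
by rewrite mulrA divfK// lt0r_neq0.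
Qed.

Hypothesis phi_schur : schur_rhp phi.

Lemma schur_contr l : rhp l -> forall u, `|phi l u| <= `|u|.
Proof. by case: phi_schur => _ h /h. Qed.

Lemma tilde_contr l : rhp l -> forall y, `|tilde phi l y| <= `|y|.
Proof. by move=> /rhp_conj/schur_contr; exact: adjoint_contr. Qed.

Lemma tilde_linear l : rhp l -> linear (tilde phi l).
Proof. by move=> /rhp_conj/schur_contr; exact: adjoint_linear. Qed.

Lemma tilde_0 l : tilde phi l 0 = 0.
Proof. exact: adjoint0. Qed.

Lemma tilde_Z l c y : rhp l -> tilde phi l (c *: y) = c *: tilde phi l y.
Proof. by move=> hl; rewrite -[c *: y]addr0 (tilde_linear hl) tilde_0 addr0. Qed.

Lemma tilde_adjP l u y : rhp l -> hdot (tilde phi l y) u = hdot y (phi l^* u).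
Proof. by move=> /rhp_conj/schur_contr h; exact: adjointP'. Qed.

Lemma adjoint_tilde l : rhp l -> adjoint (tilde phi l) = phi l^*.
Proof. by move=> /rhp_conj/schur_contr h; apply/funext => u; exact: adjointK. Qed.

Lemma schur_near l : rhp l ->
  forall e, 0 < e -> \forall m \near l, forall u, `|phi m u - phi l u| <= e * `|u|.
Proof. by case: phi_schur => h _ /h; exact: op_derivable_continuous. Qed.

(** Taking adjoints preserves the operator norm: the difference [v] is tested against itself and the
    difference of the [phi] moved onto it. *)
Lemma tilde_near l : rhp l ->
  forall e, 0 < e -> \forall m \near l, forall y, `|tilde phi m y - tilde phi l y| <= e * `|y|.
Proof.
move=> hl e e0; have hlc := rhp_conj hl.
have h1 : \forall m \near l, forall u, `|phi m^* u - phi l^* u| <= e * `|u|.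
  exact: (@conjC_continuous R l _ (schur_near hlc e0)).
near=> m; have hm : rhp m by near: m; exact: near_rhp.
have hu : forall u, `|phi m^* u - phi l^* u| <= e * `|u| by near: m.
move=> y; set v := _ - _; have [->|v0] := eqVneq v 0.
  by rewrite normr0 mulr_ge0// ltW.
have v1 : 0 < `|v| by rewrite normr_gt0.
rewrite -(@ler_pM2l _ _ v1) -expr2.
have vE : `|v| ^+ 2 = hdot y (phi m^* v - phi l^* v).
  by rewrite hdot_norm {1}/v hdotBl !tilde_adjP// hdotBr.
rewrite -[leLHS]ger0_norm ?exprn_ge0// vE.
apply: le_trans (cauchy_schwarz _ _) _.
by rewrite mulrC mulrA [`|v| * e]mulrC ler_wpM2r.
Unshelve. all: by end_near. Qed.

End SchurContinuity.

Section HalfPlaneModel.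
Variables (R : realType) (U Y : hilbertType R).
Local Notation C := (Cplx R).
Variable phi : C -> {linear U -> Y}.

(* The off-diagonal kernel entries are prescribed away from their removable
   singularity only; continuity determines them there. *)
Record rhp_model (H : hilbertType R) (f : H -> C -> Y) (g : H -> C -> U) : Prop := RhpModel {
  model_linear1 : forall m, rhp m -> linear (f ^~ m);
  model_linear2 : forall m, rhp m -> linear (g ^~ m);
  model_ext : forall x, (forall m, rhp m -> f x m = 0) ->
    (forall m, rhp m -> g x m = 0) -> x = 0;
  model_kernel1 : forall l v, rhp l -> exists k, [/\
    forall m, rhp m -> f k m = (m + l^*)^-1 *: (v - phi m (adjoint (phi l) v)),
    forall m, rhp m -> m != l^* ->
      g k m = (m - l^*)^-1 *: (adjoint (phi l) v - tilde phi m v)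
    & forall x, hdot x k = hdot (f x l) v];
  model_kernel2 : forall l w, rhp l -> exists k, [/\
    forall m, rhp m -> m != l^* -> f k m = (m - l^*)^-1 *: (phi l^* w - phi m w),
    forall m, rhp m -> g k m = (m + l^*)^-1 *: (w - tilde phi m (phi l^* w))
    & forall x, hdot x k = hdot (g x l) w] }.

Hypothesis phi_schur : schur_rhp phi.

(** The three scalar limits that [kernel_continuous] asks of the factor 1 / (s + conj s'). *)
Lemma szego_cvg (t : C) : rhp t ->
  [/\ (s + s^*)^-1 - (t + s^*)^-1 @[s --> t] --> (0 : C^o),
      (s + t^*)^-1 - (t + t^*)^-1 @[s --> t] --> (0 : C^o)
    & (t + s^*)^-1 @[s --> t] --> ((t + t^*)^-1 : C^o)].
Proof.
move=> ht; have n0 : t + t^* != 0 by apply: rhp_add_neq0 => //; exact: rhp_conj.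
have cc : s^* @[s --> t] --> (t^* : C^o) by exact: (@conjC_continuous R t).
have id : s @[s --> t] --> (t : C^o) by exact: cvg_id.
have inv (F : C -> C) : F s @[s --> t] --> (t + t^* : C^o) ->
    (F s)^-1 @[s --> t] --> ((t + t^*)^-1 : C^o).
  by move=> Fc; exact: (@cvgV C C (nbhs t) _ F _ n0 Fc).
have add (F G : C -> C) (a b : C) : F s @[s --> t] --> (a : C^o) ->
    G s @[s --> t] --> (b : C^o) -> F s + G s @[s --> t] --> (a + b : C^o).
  by move=> Fa Gb; exact: (@cvgD C C^o C (nbhs t) _ F G a b Fa Gb).
have sub (F G : C -> C) : F s @[s --> t] --> ((t + t^*)^-1 : C^o) ->
    G s @[s --> t] --> ((t + t^*)^-1 : C^o) -> F s - G s @[s --> t] --> (0 : C^o).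
  move=> Fa Gb; rewrite -[X in _ --> X](subrr ((t + t^*)^-1)).
  exact: (@cvgB C C^o C (nbhs t) _ F G _ _ Fa Gb).
have cst (b : C) : b @[s --> t] --> (b : C^o) by exact: (@cvg_cst C^o b C (nbhs t)).
have c1 : (t + s^*)^-1 @[s --> t] --> ((t + t^*)^-1 : C^o).
  exact: (inv (fun s => t + s^*) (add (fun=> t) (fun s => s^*) _ _ (cst t) cc)).
have c2 : (s + s^*)^-1 @[s --> t] --> ((t + t^*)^-1 : C^o).
  exact: (inv (fun s => s + s^*) (add (fun s => s) (fun s => s^*) _ _ id cc)).
have c3 : (s + t^*)^-1 @[s --> t] --> ((t + t^*)^-1 : C^o).
  exact: (inv (fun s => s + t^*) (add (fun s => s) (fun=> t^*) _ _ id (cst t^*))).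
have c4 : (t + t^*)^-1 @[s --> t] --> ((t + t^*)^-1 : C^o) by exact: cst.
split; last exact: c1.
- exact: (sub (fun s => (s + s^*)^-1) (fun s => (t + s^*)^-1) c2 c1).
- exact: (sub (fun s => (s + t^*)^-1) (fun s => (t + t^*)^-1) c3 c4).
Qed.

Variables (H : hilbertType R) (f : H -> C -> Y) (g : H -> C -> U).
Hypothesis mod : rhp_model f g.

Lemma model_continuous1 x t : rhp t -> f x s @[s --> t] --> f x t.
Proof.
move=> ht; have [q1 q2 q3] := szego_cvg ht.
apply: (@kernel_continuous _ H Y U (@rhp R) f (fun s s' => (s + s'^*)^-1) phi
  (fun s => adjoint (phi s)) _ _ _ x t ht _ q1 q2 q3 _).
- by move=> s v /(model_kernel1 mod v)[k [fk _ xk]]; exists k.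
- by move=> s; apply: schur_contr.
- by move=> s /(schur_contr phi_schur); exact: adjoint_contr.
- exact: near_rhp.
- exact: schur_near.
Qed.

Lemma model_continuous2 x t : rhp t -> g x s @[s --> t] --> g x t.
Proof.
move=> ht; have [q1 q2 q3] := szego_cvg ht.
apply: (@kernel_continuous _ H U Y (@rhp R) g (fun s s' => (s + s'^*)^-1) (tilde phi)
  (fun s => phi s^*) _ _ _ x t ht _ q1 q2 q3 _).
- by move=> s v /(model_kernel2 mod v)[k [_ gk xk]]; exists k.
- by move=> s; apply: tilde_contr.
- by move=> s /rhp_conj; exact: schur_contr.
- exact: near_rhp.
- exact: tilde_near.
Qed.

End HalfPlaneModel.

(** * Uniqueness of the model up to unitary equivalence *)

Section ModelUniqueness.
Variables (R : realType) (U Y : hilbertType R).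
Local Notation C := (Cplx R).
Variable phi : C -> {linear U -> Y}.
Hypothesis phi_schur : schur_rhp phi.

Lemma dnbhs_rhp (l : C) : rhp l -> \forall m \near l^', rhp m /\ m != l.
Proof.
move=> hl; apply: filterI; first exact: (@cvg_within _ (nbhs (l : C)) _ _ _ (near_rhp hl)).
exact: (@withinT C (nbhs (l : C))).
Qed.

Section OneModel.
Variables (H : hilbertType R) (f : H -> C -> Y) (g : H -> C -> U).
Hypothesis mod : rhp_model phi f g.

Lemma kernel1_eval (l : C) v k : rhp l -> (forall x, hdot x k = hdot (f x l) v) ->
  (forall m, rhp m -> f k m = (m + l^*)^-1 *: (v - phi m (adjoint (phi l) v))) /\
  (forall m, rhp m -> m != l^* ->
    g k m = (m - l^*)^-1 *: (adjoint (phi l) v - tilde phi m v)).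
Proof.
move=> hl hk; have [k' [h1 h2 h3]] := model_kernel1 mod v hl.
by have -> : k = k' by apply: hdot_extr => x; rewrite hk h3.
Qed.

Lemma kernel2_eval (l : C) w k : rhp l -> (forall x, hdot x k = hdot (g x l) w) ->
  (forall m, rhp m -> m != l^* -> f k m = (m - l^*)^-1 *: (phi l^* w - phi m w)) /\
  (forall m, rhp m -> g k m = (m + l^*)^-1 *: (w - tilde phi m (phi l^* w))).
Proof.
move=> hl hk; have [k' [h1 h2 h3]] := model_kernel2 mod w hl.
by have -> : k = k' by apply: hdot_extr => x; rewrite hk h3.
Qed.

(** Cancelling a factor m - a gives vanishing only away from [a]; continuity restores the missing
    point. *)
Lemma model_eq0_1 x (a : C) : rhp a -> (forall m, rhp m -> m != a -> f x m = 0) ->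
  forall m, rhp m -> f x m = 0.
Proof.
move=> ha h m hm; have [->|/h//] := eqVneq m a; last exact.
apply: (@continuous_agree _ _ (f x) (cst 0) a).
- by apply: filterS (dnbhs_rhp ha) => w [hw wa]; rewrite h.
- exact: (model_continuous1 phi_schur mod ha).
- exact: (@cvg_cst Y 0 C (nbhs a)).
Qed.

Lemma model_eq0_2 x (a : C) : rhp a -> (forall m, rhp m -> m != a -> g x m = 0) ->
  forall m, rhp m -> g x m = 0.
Proof.
move=> ha h m hm; have [->|/h//] := eqVneq m a; last exact.
apply: (@continuous_agree _ _ (g x) (cst 0) a).
- by apply: filterS (dnbhs_rhp ha) => w [hw wa]; rewrite h.
- exact: (model_continuous2 phi_schur mod ha).
- exact: (@cvg_cst U 0 C (nbhs a)).
Qed.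

End OneModel.

(** Kernel functions representing the same evaluation are paired. By [agree] the paired functions
    have equal values everywhere, at the removable singularity by continuity, and these values are
    the Gram matrices. *)
Lemma rhp_model_unitary (H H' : hilbertType R) (f : H -> C -> Y) (g : H -> C -> U)
    (f' : H' -> C -> Y) (g' : H' -> C -> U) :
  rhp_model phi f g -> rhp_model phi f' g' ->
  exists2 T : H -> H', unitary_op T &
    forall x m, rhp m -> f' (T x) m = f x m /\ g' (T x) m = g x m.
Proof.
move=> mod mod'.
pose S1 : set (H * H') := [set p | exists (l : C) v, [/\ rhp l,
  forall x, hdot x p.1 = hdot (f x l) v & forall x, hdot x p.2 = hdot (f' x l) v]].
pose S2 : set (H * H') := [set p | exists (l : C) w, [/\ rhp l,
  forall x, hdot x p.1 = hdot (g x l) w & forall x, hdot x p.2 = hdot (g' x l) w]].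
have S1ex (l : C) v : rhp l -> exists2 p, S1 p &
    (forall x, hdot x p.1 = hdot (f x l) v) /\ (forall x, hdot x p.2 = hdot (f' x l) v).
  move=> hl; have [k [_ _ hk]] := model_kernel1 mod v hl.
  have [k' [_ _ hk']] := model_kernel1 mod' v hl.
  by exists (k, k') => //; exists l, v.
have S2ex (l : C) w : rhp l -> exists2 p, S2 p &
    (forall x, hdot x p.1 = hdot (g x l) w) /\ (forall x, hdot x p.2 = hdot (g' x l) w).
  move=> hl; have [k [_ _ hk]] := model_kernel2 mod w hl.
  have [k' [_ _ hk']] := model_kernel2 mod' w hl.
  by exists (k, k') => //; exists l, w.
have agree p : (S1 `|` S2) p -> forall m, rhp m -> f p.1 m = f' p.2 m /\ g p.1 m = g' p.2 m.
  case=> -[l [v [hl h1 h2]]] m hm.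
  - have [e1 e2] := kernel1_eval mod hl h1; have [e1' e2'] := kernel1_eval mod' hl h2.
    rewrite e1// e1'//; split=> //.
    have [->|ml] := eqVneq m l^*; last by rewrite e2// e2'.
    have hlc := rhp_conj hl.
    apply: (@continuous_agree _ _ (g p.1) (g' p.2) l^*).
    + by apply: filterS (dnbhs_rhp hlc) => w [hw wl]; rewrite e2// e2'.
    + exact: (model_continuous2 phi_schur mod hlc).
    + exact: (model_continuous2 phi_schur mod' hlc).
  - have [e1 e2] := kernel2_eval mod hl h1; have [e1' e2'] := kernel2_eval mod' hl h2.
    rewrite e2// e2'//; split=> //.
    have [->|ml] := eqVneq m l^*; last by rewrite e1// e1'.
    have hlc := rhp_conj hl.
    apply: (@continuous_agree _ _ (f p.1) (f' p.2) l^*).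
    + by apply: filterS (dnbhs_rhp hlc) => w [hw wl]; rewrite e1// e1'.
    + exact: (model_continuous1 phi_schur mod hlc).
    + exact: (model_continuous1 phi_schur mod' hlc).
have [p q Sp|x hx|y hy|T uT hT] := @unitary_of_pairs _ _ _ (S1 `|` S2).
- case=> -[l [v [hl h1 h2]]]; rewrite h1 h2.
    by have [-> _] := agree _ Sp _ hl.
  by have [_ ->] := agree _ Sp _ hl.
- apply: (model_ext mod) => m hm; apply: hdot_eq0.
  + by have [p Sp [h1 _]] := S1ex m (f x m) hm; rewrite -h1 hx//; left.
  + by have [p Sp [h1 _]] := S2ex m (g x m) hm; rewrite -h1 hx//; right.
- apply: (model_ext mod') => m hm; apply: hdot_eq0.
  + by have [p Sp [_ h1]] := S1ex m (f' y m) hm; rewrite -h1 hy//; left.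
  + by have [p Sp [_ h1]] := S2ex m (g' y m) hm; rewrite -h1 hy//; right.
exists T => // x m hm; have {}hT := (hT x (T x)).2 erefl.
split; apply: hdot_ext => v.
- by have [p Sp [h1 h2]] := S1ex m v hm; rewrite -h1 -h2 hT//; left.
- by have [p Sp [h1 h2]] := S2ex m v hm; rewrite -h1 -h2 hT//; right.
Qed.

End ModelUniqueness.

(** * The Cayley transform as a relation between functions *)

Section ModelCayley.
Variables (R : realType) (U Y : hilbertType R).
Local Notation C := (Cplx R).
Variable phi : C -> {linear U -> Y}.
Hypothesis phi_schur : schur_rhp phi.
Variables (H : hilbertType R) (f : H -> C -> Y) (g : H -> C -> U).
Hypothesis mod : rhp_model phi f g.

Lemma model_Z1 (c m : C) x : rhp m -> f (c *: x) m = c *: f x m.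
Proof.
move=> hm; have lf := model_linear1 mod hm.
have f0 : f 0 m = 0 by have := lf (-1) 0 0; rewrite scaler0 addr0 scaleN1r addNr.
by rewrite -[c *: x]addr0 lf f0 addr0.
Qed.

Lemma model_Z2 (c m : C) x : rhp m -> g (c *: x) m = c *: g x m.
Proof.
move=> hm; have lg := model_linear2 mod hm.
have g0 : g 0 m = 0 by have := lg (-1) 0 0; rewrite scaler0 addr0 scaleN1r addNr.
by rewrite -[c *: x]addr0 lg g0 addr0.
Qed.

Lemma model_D1 (m : C) x y : rhp m -> f (x + y) m = f x m + f y m.
Proof. by move=> hm; have := model_linear1 mod hm 1 x y; rewrite !scale1r. Qed.

Lemma model_D2 (m : C) x y : rhp m -> g (x + y) m = g x m + g y m.
Proof. by move=> hm; have := model_linear2 mod hm 1 x y; rewrite !scale1r. Qed.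

Lemma model_B1 (m : C) x y : rhp m -> f (x - y) m = f x m - f y m.
Proof. by move=> hm; rewrite -[- y]scaleN1r model_D1// model_Z1// scaleN1r. Qed.

Lemma model_B2 (m : C) x y : rhp m -> g (x - y) m = g x m - g y m.
Proof. by move=> hm; rewrite -[- y]scaleN1r model_D2// model_Z2// scaleN1r. Qed.

Lemma cayley_scale_gt0 (a : C) : rhp a -> 0 < sqrtC (2 * 'Re a).
Proof. by move=> ha; rewrite sqrtC_gt0 mulr_gt0. Qed.

Lemma cayley_scale_sqr (a : C) : sqrtC (2 * 'Re a) * sqrtC (2 * 'Re a) = a + a^*.
Proof. by rewrite -expr2 sqrtCK twice_Re. Qed.

Lemma cayley_scale_conj (a : C) : rhp a -> (sqrtC (2 * 'Re a))^* = sqrtC (2 * 'Re a).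
Proof. by move=> /cayley_scale_gt0/ltW; exact: geC0_conj. Qed.

(* The graph of the Cayley transform, with the denominators cleared. *)
Definition cayley_rel (a : C) (p : dsum H U) (q : dsum H Y) : Prop :=
  forall m, rhp m ->
    (a - m) *: f q.1 m = (a^* + m) *: f p.1 m - sqrtC (2 * 'Re a) *: q.2
      + sqrtC (2 * 'Re a) *: phi m p.2 /\
    (a + m) *: g q.1 m = (a^* - m) *: g p.1 m - sqrtC (2 * 'Re a) *: tilde phi m q.2
      + sqrtC (2 * 'Re a) *: p.2.

Lemma cayley_rel_unitary (a : C) : rhp a -> exists2 T : dsum H U -> dsum H Y, unitary_op T &
  forall p q, cayley_rel a p q <-> q = T p.
Proof.
move=> ha; set c := sqrtC (2 * 'Re a).
have c0 : c != 0 by rewrite lt0r_neq0// cayley_scale_gt0.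
have cc : c^* = c := cayley_scale_conj ha.
have c2 : c * c = a + a^* := cayley_scale_sqr a.
(* These pairs are the first equation of [cayley_rel] at [l], tested with [v] and written as inner
   products with kernel functions; coefficients are conjugated since [hdot] is antilinear on the
   right. [S2] does the same for the second equation. *)
pose S1 : set (dsum H U * dsum H Y) := [set p | exists (l : C) v k, [/\ rhp l,
  forall x, hdot x k = hdot (f x l) v,
  p.1 = ((a + l^*) *: k, c *: adjoint (phi l) v) &
  p.2 = ((a^* - l^*) *: k, c *: v)]].
pose S2 : set (dsum H U * dsum H Y) := [set p | exists (l : C) w k, [/\ rhp l,
  forall x, hdot x k = hdot (g x l) w,
  p.1 = ((a - l^*) *: k, c *: w) &
  p.2 = ((a^* + l^*) *: k, c *: phi l^* w)]].
have rel p q : (forall s, (S1 `|` S2) s -> hdot p s.1 = hdot q s.2) <-> cayley_rel a p q.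
  rewrite /cayley_rel -/c; split=> [h m hm|h s].
    split; apply: hdot_ext => v.
      have [k [_ _ hk]] := model_kernel1 mod v hm.
      have := h (((a + m^*) *: k, c *: adjoint (phi m) v), ((a^* - m^*) *: k, c *: v))
        (or_introl (ex_intro _ m (ex_intro _ v (ex_intro _ k
          (And4 hm hk erefl erefl))))).
      rewrite !dsum_hdotE/= !hdotE !hk -(adjointP (schur_contr phi_schur hm)).
      rewrite !(rmorphD, rmorphN)/= !conjCK cc => /eqP.
      by rewrite -subr_eq => /eqP <-; ring.
    have [k [_ _ hk]] := model_kernel2 mod v hm.
    have := h (((a - m^*) *: k, c *: v), ((a^* + m^*) *: k, c *: phi m^* v))
      (or_intror (ex_intro _ m (ex_intro _ v (ex_intro _ k
        (And4 hm hk erefl erefl))))).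
    rewrite !dsum_hdotE/= !hdotE !hk -(tilde_adjP phi_schur _ _ hm).
    rewrite !(rmorphD, rmorphN)/= !conjCK cc => /eqP.
    by rewrite -subr_eq => /eqP <-; ring.
  case=> -[l [v [k [hl hk -> ->]]]].
    rewrite !dsum_hdotE/= !hdotE !hk -(adjointP (schur_contr phi_schur hl)).
    rewrite !(rmorphD, rmorphN)/= !conjCK cc; have [+ _] := h l hl.
    by move=> /(congr1 (fun x => hdot x v)); rewrite !hdotE => ->; ring.
  rewrite !dsum_hdotE/= !hdotE !hk -(tilde_adjP phi_schur _ _ hl).
  rewrite !(rmorphD, rmorphN)/= !conjCK cc; have [_] := h l hl.
  by move=> /(congr1 (fun x => hdot x v)); rewrite !hdotE => ->; ring.
have c2E x : c * (c * x) = (a + a^*) * x by rewrite mulrA c2.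
(* Every pair of the family is itself in the relation; read through [rel], this is the equality of
   the Gram matrices. *)
have gram s : (S1 `|` S2) s -> cayley_rel a s.1 s.2.
  case=> -[l [v [k [hl hk -> ->]]]] m hm /=; rewrite -/c.
    have [e1 e2] := kernel1_eval mod hl hk; have n0 := rhp_add_neq0 hm (rhp_conj hl).
    rewrite !model_Z1// !model_Z2// [phi m _]linearZ tilde_Z//=.
    split; apply: hdot_ext => w; rewrite ?e1// !hdotE !c2E; first by field.
    (* The value of [g k] at m = conj l is not prescribed, but its total coefficient (a + conj a)(m
       - conj l) vanishes there. *)
    have [->|ml] := eqVneq m l^*; first by rewrite /tilde conjCK; ring.
    by rewrite e2// !hdotE; field; rewrite subr_eq0.
  have [e1 e2] := kernel2_eval mod hl hk; have n0 := rhp_add_neq0 hm (rhp_conj hl).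
  rewrite !model_Z1// !model_Z2// [phi m _]linearZ tilde_Z//=.
  split; apply: hdot_ext => u; rewrite ?e2// !hdotE !c2E; last by field.
  have [->|ml] := eqVneq m l^*; first by ring.
  by rewrite e1// !hdotE; field; rewrite subr_eq0.
have [s t /gram/rel hs /hs//|p hp|q hq|T uT hT] := @unitary_of_pairs _ _ _ (S1 `|` S2).
- have /rel hr : forall s, (S1 `|` S2) s -> hdot p s.1 = hdot (0 : dsum H Y) s.2.
    by move=> s /hp ->; rewrite hdot0l.
  have zero m : rhp m -> f 0 m = 0 /\ g 0 m = 0.
    by move=> hm; rewrite -[0 : H](scale0r 0) model_Z1// model_Z2// !scale0r.
  (* At m = conj a the state term of the second equation drops out and only [p.2] remains. *)
  have p20 : p.2 = 0.
    have [_] := hr _ (rhp_conj ha); have [_ ->] := zero _ (rhp_conj ha).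
    rewrite tilde_0/= subrr scale0r !scaler0 subr0 add0r => /esym/eqP.
    by rewrite scaler_eq0 (negbTE c0) => /eqP.
  have eq1 m : rhp m -> f p.1 m = 0.
    move=> hm; have [+ _] := hr m hm; have [-> _] := zero m hm.
    rewrite p20 [phi m 0]linear0/= !scaler0 subr0 addr0 => /esym/eqP.
    by rewrite scaler_eq0 (negbTE (rhp_add_neq0 (rhp_conj ha) hm)) => /eqP.
  have eq2 m : rhp m -> m != a^* -> g p.1 m = 0.
    move=> hm ma; have [_] := hr m hm; have [_ ->] := zero m hm.
    rewrite p20 tilde_0/= !scaler0 subr0 addr0 => /esym/eqP.
    by rewrite scaler_eq0 subr_eq0 eq_sym (negbTE ma) => /eqP.
  rewrite [p]surjective_pairing p20; congr pair.
  by apply: (model_ext mod) => // m hm; apply: (model_eq0_2 phi_schur mod (rhp_conj ha)).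
- have /rel hr : forall s, (S1 `|` S2) s -> hdot (0 : dsum H U) s.1 = hdot q s.2.
    by move=> s /hq ->; rewrite hdot0l.
  have zero m : rhp m -> f 0 m = 0 /\ g 0 m = 0.
    by move=> hm; rewrite -[0 : H](scale0r 0) model_Z1// model_Z2// !scale0r.
  (* Likewise, at m = a the first equation leaves only [q.2]. *)
  have q20 : q.2 = 0.
    have [+ _] := hr _ ha; have [-> _] := zero _ ha.
    rewrite [phi a 0]linear0/= subrr scale0r !scaler0 addr0 sub0r => /esym/eqP.
    by rewrite oppr_eq0 scaler_eq0 (negbTE c0) => /eqP.
  have eq1 m : rhp m -> m != a -> f q.1 m = 0.
    move=> hm ma; have [+ _] := hr m hm; have [-> _] := zero m hm.
    rewrite q20 /= ?[phi m 0]linear0 !scaler0 subr0 addr0 => /eqP.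
    by rewrite scaler_eq0 subr_eq0 eq_sym (negbTE ma) => /eqP.
  have eq2 m : rhp m -> g q.1 m = 0.
    move=> hm; have [_] := hr m hm; have [_ ->] := zero m hm.
    rewrite q20 tilde_0/= !scaler0 subr0 addr0 => /eqP.
    by rewrite scaler_eq0 (negbTE (rhp_add_neq0 ha hm)) => /eqP.
  rewrite [q]surjective_pairing q20; congr pair.
  by apply: (model_ext mod) => // m hm; apply: (model_eq0_1 phi_schur mod ha).
- by exists T => // p q; rewrite -rel; exact: hT.
Qed.

End ModelCayley.

(** * The conservative model as a system node *)

Section ModelNode.
Variables (R : realType) (U Y : hilbertType R).
Local Notation C := (Cplx R).
Variable phi : C -> {linear U -> Y}.
Hypothesis phi_schur : schur_rhp phi.
Variables (H : hilbertType R) (f : H -> C -> Y) (g : H -> C -> U).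
Hypothesis mod : rhp_model phi f g.
Local Notation S := (Ss phi f g).
Local Notation scale a := (sqrtC (2 * 'Re a)).

(** The substitution is h = (a x - z) / c and k = (conj a x + z) / c, with inverse x = (h + k) / c
    and z = (a k - conj a h) / c, where c^2 = a + conj a. Under it the residuals of the two systems
    of equations differ by the factor c. *)
Lemma Ss_cayley_rel (a : C) x u z y : rhp a ->
  S ((x, u), (z, y)) <->
  cayley_rel phi f g a ((scale a)^-1 *: (a *: x - z), u) ((scale a)^-1 *: (a^* *: x + z), y).
Proof.
move=> ha; rewrite /cayley_rel/=; set c := scale a.
have c0 : c != 0 by rewrite lt0r_neq0// cayley_scale_gt0.
(* Eliminating conj a leaves [field] an identity in which c and a are independent. *)
have ca : a^* = c * c - a by rewrite cayley_scale_sqr addrC addKr.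
have id1 (m : C) (fx fz P : Y) :
    (a - m) *: (c^-1 *: (a^* *: fx + fz)) -
    ((a^* + m) *: (c^-1 *: (a *: fx - fz)) - c *: y + c *: P) =
    c *: (fz - (m *: fx + P - y)).
  by apply: hdot_ext => v; rewrite !hdotE ca; field.
have id2 (m : C) (gx gz t : U) :
    (a + m) *: (c^-1 *: (a^* *: gx + gz)) -
    ((a^* - m) *: (c^-1 *: (a *: gx - gz)) - c *: t + c *: u) =
    c *: (gz - (- (m *: gx) + u - t)).
  by apply: hdot_ext => v; rewrite !hdotE ca; field.
have eq0 (V : lmodType C) (v w : V) : c *: (v - w) = 0 -> v = w.
  by move/eqP; rewrite scaler_eq0 (negbTE c0) subr_eq0 => /eqP.
split=> [h m hm|h m n hm hn].
  have [e1 e2] := h m m hm hm.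
  rewrite !(model_Z1 mod)// !(model_B1 mod)// !(model_D1 mod)// !(model_Z1 mod)//.
  rewrite !(model_Z2 mod)// !(model_B2 mod)// !(model_D2 mod)// !(model_Z2 mod)//.
  split; apply/eqP; rewrite -subr_eq0; apply/eqP.
    by rewrite id1 e1 subrr scaler0.
  by rewrite id2 e2 subrr scaler0.
have [+ _] := h m hm; have [_] := h n hn.
rewrite !(model_Z1 mod)// !(model_B1 mod)// !(model_D1 mod)// !(model_Z1 mod)//.
rewrite !(model_Z2 mod)// !(model_B2 mod)// !(model_D2 mod)// !(model_Z2 mod)//.
move=> e2 e1; split; apply: eq0.
  by rewrite -id1 e1 subrr.
by rewrite -id2 e2 subrr.
Qed.

Lemma Ss_of_cayley_rel (a : C) (p : dsum H U) (q : dsum H Y) : rhp a ->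
  cayley_rel phi f g a p q ->
  S (((scale a)^-1 *: (p.1 + q.1), p.2), ((scale a)^-1 *: (a *: q.1 - a^* *: p.1), q.2)).
Proof.
move=> ha h; apply/(Ss_cayley_rel _ _ _ _ ha).
have c0 : scale a != 0 by rewrite lt0r_neq0// cayley_scale_gt0.
have ca : a^* = scale a * scale a - a by rewrite cayley_scale_sqr addrC addKr.
set h1 := _ *: (_ - _); set k1 := _ *: (_ + _).
have -> : h1 = p.1 by apply: hdot_ext => v; rewrite /h1 !hdotE ca; field.
have -> : k1 = q.1.
  by apply: hdot_ext => v; rewrite /k1 !hdotE ca; field.
by rewrite -!surjective_pairing.
Qed.

Lemma Ss_linear : linear_graph S.
Proof.
have lin (a : C) p q : rhp a -> S p -> S q -> forall l : C, S (l *: p + q).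
  case: p q => [[x u] [z y]] [[x' u'] [z' y']] ha hp hq l.
  move=> m n hm hn; have [e1 e2] := hp m n hm hn; have [e1' e2'] := hq m n hm hn.
  rewrite !(model_D1 mod)// !(model_Z1 mod)// !(model_D2 mod)// !(model_Z2 mod)//.
  rewrite e1 e2 e1' e2' (tilde_linear phi_schur hn) (linearP (phi m)).
  by split; apply: hdot_ext => v; rewrite !hdotE; ring.
split; last by move=> a p q hp hq; exact: (lin 1 p q (@rhp1 R) hp hq).
move=> m n hm hn.
rewrite -(scale0r (0 : H)) (model_Z1 mod)// (model_Z2 mod)// !scale0r [phi m 0]linear0 !scaler0.
by rewrite tilde_0 !oppr0 !addr0.
Qed.

(** For parameter 1, isometry reads |h|^2 + |u|^2 = |k|^2 + |y|^2 with h, k = (x - z) / c, (x + z) /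
    c and c^2 = 2; polarization gives the balance. *)
Lemma Ss_energy x u z y : S ((x, u), (z, y)) ->
  2 * 'Re (hdot z x) = `|u| ^+ 2 - `|y| ^+ 2.
Proof.
have h1 := @rhp1 R; have [T uT hT] := cayley_rel_unitary phi_schur mod h1.
move=> /(Ss_cayley_rel _ _ _ _ h1)/hT/(congr1 (fun w => `|w| ^+ 2)).
set c := scale 1.
have c0 : c != 0 by rewrite lt0r_neq0// cayley_scale_gt0.
have c2 : c * c = 1 + 1 by rewrite cayley_scale_sqr conjC1.
have cc : c^* = c := cayley_scale_conj h1.
have d2 : 1 - c^-1 * c^-1 * (1 + 1) = 0 by rewrite -c2; field.
rewrite (unitary_norm _ uT) !hdot_norm !dsum_hdotE/= !hdotE (hdotC x z).
rewrite !fmorphV/= cc !conjC1 twice_Re => /eqP; rewrite -subr_eq0 => /eqP e.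
(* [ring] cannot use c^2 = 2, so the explicit multiple of the relation [d2] is supplied as [W]. *)
have key (P Q D W : C) : Q = 0 -> D = 0 -> P = Q + D * W -> P = 0.
  by move=> -> -> ->; rewrite mul0r addr0.
apply/eqP; rewrite -subr_eq0; apply/eqP.
by apply: (key _ _ _ (hdot z x + (hdot z x)^*) e d2); ring.
Qed.

Lemma Ss_comb (l : C) x u z y x' u' z' y' :
  S ((x, u), (z, y)) -> S ((x', u'), (z', y')) ->
  S ((l *: x + x', l *: u + u'), (l *: z + z', l *: y + y')).
Proof. exact: Ss_linear.2. Qed.

Lemma Ss_sub x u z y x' u' z' y' :
  S ((x, u), (z, y)) -> S ((x', u'), (z', y')) ->
  S ((x - x', u - u'), (z - z', y - y')).
Proof.
by move=> h h'; have := Ss_comb (-1) h' h; rewrite !scaleN1r ![- _ + _]addrC.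
Qed.

(** For a difference with x = 0 and u = 0 the energy balance gives y = 0, and then the defining
    formulas give z = 0. *)
Lemma Ss_single_valued : single_valued S.
Proof.
move=> [x u] [z y] [z' y'] h h'; have := Ss_sub h h'; rewrite !subrr => h0.
have := Ss_energy h0; rewrite hdot0r raddf0 mulr0 normr0 expr0n/= sub0r.
move=> /esym/eqP; rewrite oppr_eq0 sqrf_eq0 normr_eq0 subr_eq0 => /eqP y0.
move: h0; rewrite y0 subrr => h0; congr pair.
apply/eqP; rewrite -subr_eq0; apply/eqP.
have zero m : rhp m -> f 0 m = 0 /\ g 0 m = 0.
  by move=> hm; rewrite -[0 : H](scale0r 0) (model_Z1 mod)// (model_Z2 mod)// !scale0r.
apply: (model_ext mod) => m hm; have [e1 e2] := h0 m m hm hm; have [z1 z2] := zero m hm.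
  by rewrite e1 z1 [phi m 0]linear0 scaler0 !(oppr0, addr0).
by rewrite e2 z2 tilde_0 scaler0 !(oppr0, addr0).
Qed.

Lemma Ss_resolvent (a : C) x : rhp a ->
  exists w z y, S ((w, 0), (z, y)) /\ a *: w - z = x.
Proof.
move=> ha; have [T uT hT] := cayley_rel_unitary phi_schur mod ha.
have c0 : scale a != 0 by rewrite lt0r_neq0// cayley_scale_gt0.
have ca : a^* = scale a * scale a - a by rewrite cayley_scale_sqr addrC addKr.
(* The state argument of [T] is (a w - z) / c, where a w - z = x is prescribed. *)
have := Ss_of_cayley_rel ha ((hT ((scale a)^-1 *: x, 0) _).2 erefl).
set q := T _; move=> h.
do 3 eexists; split; first exact: h.
by apply: hdot_ext => v; rewrite /= !hdotE ca; field.
Qed.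

(** Dissipativity: without input the energy balance gives Re <z, w> <= 0, so Re <a w - z, w> >= Re a
    |w|^2. *)
Lemma Ss_resolvent_le (a : C) w z y : rhp a -> S ((w, 0), (z, y)) ->
  'Re a * `|w| <= `|a *: w - z|.
Proof.
move=> ha h; have := Ss_energy h; rewrite normr0 expr0n/= sub0r => e.
have [->|w0] := eqVneq w 0; first by rewrite normr0 mulr0.
have w1 : 0 < `|w| by rewrite normr_gt0.
rewrite -(ler_pM2r w1) -mulrA -expr2.
apply: le_trans (cauchy_schwarz _ _).
apply: (@le_trans _ _ ('Re (hdot (a *: w - z) w))); last first.
  apply: le_trans (real_ler_norm (Creal_Re _)) _.
  by case: (leif_normC_Re_Creal (hdot (a *: w - z) w)).
rewrite hdotBl hdotZl raddfB/= -hdot_norm.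
have rw : `|w| ^+ 2 \is Num.real by rewrite ger0_real// exprn_ge0.
rewrite ReMr// lerDl oppr_ge0 -(@pmulr_rle0 _ 2)//.
by rewrite e oppr_le0 exprn_ge0.
Qed.

Lemma main_op_B w z w' z' : main_op S (w, z) -> main_op S (w', z') ->
  main_op S (w - w', z - z').
Proof.
by move=> [y h] [y' h']; exists (y - y'); have := Ss_sub h h'; rewrite subr0.
Qed.

Lemma main_op_Z (l : C) w z : main_op S (w, z) -> main_op S (l *: w, l *: z).
Proof.
move=> [y h]; exists (l *: y).
by have := Ss_comb l h Ss_linear.1; rewrite scaler0 !addr0.
Qed.

Lemma resolvent_unique (a : C) w z : rhp a -> main_op S (w, z) -> a *: w = z -> w = 0.
Proof.
move=> ha [y h] e; have := Ss_resolvent_le ha h; rewrite e subrr normr0.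
by rewrite pmulr_rle0// normr_le0 => /eqP.
Qed.

Lemma resolventP (a : C) x : rhp a ->
  exists2 z, main_op S (resolvent (main_op S) a x, z) & a *: resolvent (main_op S) a x - z = x.
Proof.
move=> ha; rewrite /resolvent; case: xgetP => [w _ //|no].
have [w [z [y [h e]]]] := Ss_resolvent x ha.
by case: (no w); exists z => //; exists y.
Qed.

Lemma resolvent_eq (a : C) w z : rhp a -> main_op S (w, z) ->
  resolvent (main_op S) a (a *: w - z) = w.
Proof.
move=> ha h; have [z' h' e] := resolventP (a *: w - z) ha.
apply/eqP; rewrite -subr_eq0; apply/eqP.
apply: (resolvent_unique ha (main_op_B h' h)).
move/eqP: e; rewrite -subr_eq0 opprB addrACA -opprD => /eqP e.
apply/eqP; rewrite -subr_eq0 -{}e; apply/eqP.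
by apply: hdot_ext => v; rewrite !hdotE; ring.
Qed.

Lemma resolvent_linear (a : C) : rhp a -> linear (resolvent (main_op S) a).
Proof.
move=> ha l x y; have [z h e] := resolventP x ha; have [z' h' e'] := resolventP y ha.
set r := resolvent _ a x in h e *; set r' := resolvent _ a y in h' e' *.
have [t ht] := main_op_B h' (main_op_Z (- l) h).
have hs : main_op S (l *: r + r', l *: z + z').
  by exists t; move: ht; rewrite !scaleNr !opprK ![_ + l *: _]addrC.
rewrite -(resolvent_eq ha hs); congr (resolvent _ a _).
by rewrite -{1}e -{1}e'; apply: hdot_ext => v; rewrite !hdotE; ring.
Qed.

Lemma resolvent_le (a : C) x : rhp a -> `|resolvent (main_op S) a x| <= ('Re a)^-1 * `|x|.
Proof.
move=> ha; have [z [y h] e] := resolventP x ha.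
have := Ss_resolvent_le ha h; rewrite e.
by rewrite ler_pdivlMl.
Qed.

Lemma resolvent_continuous (a : C) : rhp a -> continuous (resolvent (main_op S) a).
Proof.
move=> ha; apply: (@bounded_additive_continuous _ _ _ _ ('Re a)^-1) => [x y||x].
- rewrite addrC -scaleN1r resolvent_linear// scaleN1r addrC//.
- by rewrite invr_ge0 ltW.
- exact: resolvent_le.
Qed.

(** Write a vector orthogonal to the domain as w - z with z = A w. Then |w|^2 = <w, z>, whose real
    part is nonpositive by the energy balance, so w = 0 and z = 0. *)
Lemma main_op_dense : dense [set x | exists z, main_op S (x, z)].
Proof.
apply: dense_subspace => [|v hv].
  split=> [|a x y [z [t h]] [z' [t' h']]].
    by exists 0, 0; exact: Ss_linear.1.
  by have := Ss_comb a h h'; rewrite scaler0 addr0 => h2; do 2 eexists; exact: h2.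
have h1 := @rhp1 R.
have [w [z [y [h e]]]] := Ss_resolvent v h1.
have := hv w (ex_intro _ z (ex_intro _ y h)); rewrite -e hdotBr scale1r => /eqP.
rewrite subr_eq0 -hdot_norm => /eqP ww.
have := Ss_energy h; rewrite normr0 expr0n/= sub0r (hdotC z w) -ww.
rewrite geC0_conj ?exprn_ge0// (Creal_ReP _ _) ?ger0_real ?exprn_ge0// => en.
have w0 : w = 0.
  apply/eqP; rewrite -normr_eq0 -sqrf_eq0 eq_le exprn_ge0// andbT.
  by rewrite -(@pmulr_rle0 _ 2)// en oppr_le0 exprn_ge0.
have /(Ss_single_valued Ss_linear.1)[] : S ((0, 0), (z, y)) by rewrite -w0.
by move=> <- _; rewrite w0 subr0.
Qed.

End ModelNode.

(** * Closedness, passivity and a concrete extrapolation *)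

Section PassiveNode.
Variables (R : realType) (U Y : hilbertType R).
Local Notation C := (Cplx R).
Variable phi : C -> {linear U -> Y}.
Hypothesis phi_schur : schur_rhp phi.
Variables (H : hilbertType R) (f : H -> C -> Y) (g : H -> C -> U).
Hypothesis mod : rhp_model phi f g.
Local Notation S := (Ss phi f g).
Local Notation scale a := (sqrtC (2 * 'Re a)).

Lemma dsum_fst_continuous (V W : hilbertType R) : continuous (fst : dsum V W -> V).
Proof.
apply: (@bounded_additive_continuous _ (dsum V W) V _ 1) => [x y||x] //.
by rewrite mul1r; exact: dsum_norm_fst.
Qed.

Lemma dsum_snd_continuous (V W : hilbertType R) : continuous (snd : dsum V W -> W).
Proof.
apply: (@bounded_additive_continuous _ (dsum V W) W _ 1) => [x y||x] //.
by rewrite mul1r; exact: dsum_norm_snd.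
Qed.

Section Closed.
Variables (T : topologicalType) (X : T -> H) (V : T -> U) (Z : T -> H).
Hypotheses (Xc : continuous X) (Vc : continuous V) (Zc : continuous Z).

Lemma continuous_hdot (W : hilbertType R) (w : W) (F : T -> W) : continuous F ->
  continuous (fun t => hdot (F t) w : C^o).
Proof. by move=> Fc t; exact: (cvg_comp _ _ (Fc t) (@hdot_contl _ _ w (F t))). Qed.

(** The part of the tested defining equation that does not involve the output. The parameter space
    [T] lets one argument treat both the graph and [AB_op]. *)
Let E1 (m : C) v t : C^o :=
  hdot (f (Z t) m) v - (m * hdot (f (X t) m) v + hdot (phi m (V t)) v).
Let E2 (m : C) w t : C^o :=
  hdot (g (Z t) m) w - (hdot (V t) w - m * hdot (g (X t) m) w).

Lemma residual1_continuous (m : C) v : rhp m -> continuous (E1 m v).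
Proof.
move=> hm; have [k [_ _ hk]] := model_kernel1 mod v hm.
have -> : E1 m v = fun t => hdot (Z t) k - (m * hdot (X t) k + hdot (V t) (adjoint (phi m) v)).
  by apply/funext => t; rewrite /E1 !hk (adjointP (schur_contr phi_schur hm)).
move=> t; apply: (@cvgB C C^o); first exact: continuous_hdot.
apply: (@cvgD C C^o); last exact: continuous_hdot.
by apply: (@cvgZl_tmp C C^o); exact: continuous_hdot.
Qed.

Lemma residual2_continuous (m : C) w : rhp m -> continuous (E2 m w).
Proof.
move=> hm; have [k [_ _ hk]] := model_kernel2 mod w hm.
have -> : E2 m w = fun t => hdot (Z t) k - (hdot (V t) w - m * hdot (X t) k).
  by apply/funext => t; rewrite /E2 !hk.
move=> t; apply: (@cvgB C C^o); first exact: continuous_hdot.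
apply: (@cvgB C C^o); first exact: continuous_hdot.
by apply: (@cvgZl_tmp C C^o); exact: continuous_hdot.
Qed.

Lemma closed_zeros (I : Type) (D : set I) (F : I -> T -> C^o) :
  (forall i, D i -> continuous (F i)) -> closed [set t | forall i, D i -> F i t = 0].
Proof.
move=> Fc.
have -> : [set t | forall i, D i -> F i t = 0] = \bigcap_(i in D) F i @^-1` [set 0].
  by apply/seteqP; split.
apply: closed_bigI => i Di; apply: closed_comp; last exact: (@closed_point C C^o).
by move=> t _; exact: Fc.
Qed.

Lemma Ss_residual t y : S ((X t, V t), (Z t, y)) <->
  (forall m v, rhp m -> E1 m v t + hdot y v = 0) /\
  (forall m w, rhp m -> E2 m w t + hdot y (phi m^* w) = 0).
Proof.
split=> [h|[h1 h2] m n hm hn].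
  split=> m v hm; have [e1 e2] := h m m hm hm.
    by rewrite /E1 e1 !hdotE; ring.
  by rewrite /E2 e2 !hdotE (tilde_adjP phi_schur)//; ring.
split; apply: hdot_ext => v; apply/eqP; rewrite -subr_eq0; apply/eqP.
  by rewrite -(h1 m v hm) /E1 !hdotE; ring.
by rewrite -(h2 n v hn) /E2 !hdotE (tilde_adjP phi_schur)//; ring.
Qed.

Lemma closed_Ss_along (W : T -> Y) :
  (forall v, continuous (fun t => hdot (W t) v : C^o)) ->
  closed [set t | S ((X t, V t), (Z t, W t))].
Proof.
move=> Wc.
have -> : [set t | S ((X t, V t), (Z t, W t))] =
    [set t | forall i : C * Y, rhp i.1 -> E1 i.1 i.2 t + hdot (W t) i.2 = 0] `&`
    [set t | forall i : C * U, rhp i.1 -> E2 i.1 i.2 t + hdot (W t) (phi i.1^* i.2) = 0].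
  apply/seteqP; split=> t /=.
    by move=> /Ss_residual[h1 h2]; split=> -[m v]; [exact: h1 | exact: h2].
  by move=> [h1 h2]; apply/Ss_residual; split=> m v; [exact: (h1 (m, v)) | exact: (h2 (m, v))].
apply: closedI; apply: closed_zeros => -[m v] /= hm t; apply: (@cvgD C C^o).
- exact: residual1_continuous.
- exact: Wc.
- exact: residual2_continuous.
- exact: Wc.
Qed.

Lemma closed_Ss_output : closed [set t | exists y, S ((X t, V t), (Z t, y))].
Proof.
have h1 := @rhp1 R.
(* The first defining equation at m = 1 recovers the output, which replaces the existential
   quantifier by a weakly continuous function. *)
pose W t := 1 *: f (X t) 1 + phi 1 (V t) - f (Z t) 1.
have -> : [set t | exists y, S ((X t, V t), (Z t, y))] =
    [set t | S ((X t, V t), (Z t, W t))].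
  apply/seteqP; split=> t /=; last by exists (W t).
  move=> [y h]; suff -> : W t = y by [].
  by have [e _] := h 1 1 h1 h1; rewrite /W e opprB addrC subrK.
apply: closed_Ss_along => v.
have -> : (fun t => hdot (W t) v : C^o) = fun t => - E1 1 v t.
  by apply/funext => t; rewrite /W /E1 !hdotE; ring.
by move=> t; apply: (@cvgN C C^o); exact: residual1_continuous.
Qed.

End Closed.

Lemma Ss_closed : closed S.
Proof.
have c11 : continuous (fun p : dsum H U * dsum H Y => p.1.1).
  by move=> p; apply: cvg_comp; [exact: cvg_fst | exact: dsum_fst_continuous].
have c12 : continuous (fun p : dsum H U * dsum H Y => p.1.2).
  by move=> p; apply: cvg_comp; [exact: cvg_fst | exact: dsum_snd_continuous].
have c21 : continuous (fun p : dsum H U * dsum H Y => p.2.1).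
  by move=> p; apply: cvg_comp; [exact: cvg_snd | exact: dsum_fst_continuous].
have c22 : continuous (fun p : dsum H U * dsum H Y => p.2.2).
  by move=> p; apply: cvg_comp; [exact: cvg_snd | exact: dsum_snd_continuous].
have -> : S = [set p | S ((p.1.1, p.1.2), (p.2.1, p.2.2))].
  by apply/seteqP; split=> -[[x u] [z y]].
by apply: (closed_Ss_along c11 c12 c21) => v; exact: continuous_hdot.
Qed.

Lemma AB_op_closed : closed (AB_op S).
Proof.
have c11 : continuous (fun p : dsum H U * H => p.1.1).
  by move=> p; apply: cvg_comp; [exact: cvg_fst | exact: dsum_fst_continuous].
have c12 : continuous (fun p : dsum H U * H => p.1.2).
  by move=> p; apply: cvg_comp; [exact: cvg_fst | exact: dsum_snd_continuous].
have c2 : continuous (fun p : dsum H U * H => p.2) by move=> p; exact: cvg_snd.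
have -> : AB_op S = [set p | exists y, S ((p.1.1, p.1.2), (p.2, y))].
  by apply/seteqP; split=> -[[x u] z].
exact: (closed_Ss_output c11 c12 c2).
Qed.

(* [F u] is [(a - A_{-1})^-1 B u]. *)
Lemma Ss_input (a : C) : rhp a -> exists F : U -> H,
  [/\ linear F, exists2 M : C, 0 <= M & forall u, `|F u| <= M * `|u| &
    forall u, exists y, S ((F u, u), (a *: F u, y))].
Proof.
move=> ha; have [T uT hT] := cayley_rel_unitary phi_schur mod ha.
have c0 := cayley_scale_gt0 ha.
(* The condition z = a x means h = 0, and then x = (h + k) / c is k / c. *)
exists (fun u => (scale a)^-1 *: (T (0, u)).1); split.
- move=> l u v; have -> : (0, l *: u + v) = l *: ((0, u) : dsum H U) + (0, v).
    by congr pair; rewrite /= scaler0 addr0.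
  by case: uT => -> _ _; rewrite scalerDr !scalerA mulrC.
- exists (scale a)^-1 => [|u]; first by rewrite invr_ge0 ltW.
  rewrite normrZ ger0_norm ?invr_ge0 ?(ltW c0)// ler_wpM2l ?invr_ge0 ?(ltW c0)//.
  apply: le_trans (dsum_norm_fst _) _; rewrite (unitary_norm _ uT).
  by apply: le_trans (dsum_norm_le _) _; rewrite normr0 add0r.
- move=> u; exists (T (0, u)).2.
  have := Ss_of_cayley_rel mod ha ((hT (0, u) _).2 erefl).
  by rewrite /= add0r scaler0 subr0 !scalerA mulrC.
Qed.

Theorem Ss_passive : passive_system_node S.
Proof.
split.
- exact: (Ss_linear phi_schur mod).
- exact: (Ss_single_valued phi_schur mod).
- exact: Ss_closed.
- exact: AB_op_closed.
- move=> u; have [F [_ _ hF]] := Ss_input (@rhp1 R).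
  by have [y h] := hF u; do 2 eexists; exact: h.
- exact: (main_op_dense phi_schur mod).
- move=> a ha; split; last exact: (resolvent_continuous phi_schur mod).
  move=> x; have [z h e] := resolventP phi_schur mod x ha.
  exists (resolvent (main_op S) a x); split; first by exists z.
  by move=> w [t ht <-]; exact: (resolvent_eq phi_schur mod).
- by move=> x u z y /(Ss_energy phi_schur mod) ->.
Qed.

(** The embedding is r = (1 - A)^-1: the extrapolation norm of x is then the norm of r x in the
    state space, and the range of r is the dense domain of A. *)
Theorem Ss_extrapolation : inhabited (extrapolation S).
Proof.
have h1 := @rhp1 R.
pose r := resolvent (main_op S) 1.
have rl : linear r by exact: (resolvent_linear phi_schur mod).
have rB x y : r (x - y) = r x - r y.
  by rewrite addrC -scaleN1r rl scaleN1r addrC.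
have re w z : main_op S (w, z) -> r (w - z) = w.
  by move=> h; have := resolvent_eq phi_schur mod h1 h; rewrite scale1r.
have rc : continuous r by exact: (resolvent_continuous phi_schur mod).
pose emb : {linear H -> H} := HB.pack r (GRing.isLinear.Build _ _ _ _ r rl).
(* In this realization A_{-1} extends r A, which on the domain equals r - 1. *)
pose m x := r x - x.
have ml : linear m.
  by move=> l x y; rewrite /m rl scalerBr opprD addrACA.
have mc : continuous m.
  by move=> x; apply: cvgB; [exact: rc | exact: cvg_id].
pose main : {linear H -> H} := HB.pack m (GRing.isLinear.Build _ _ _ _ m ml).
have [F [Fl [M M0 FM] hF]] := Ss_input h1.
(* Here [emb x - main x] is x, so 1 - A_{-1} acts as the identity and B = (1 - A_{-1}) F is F
   itself. *)
pose ctrl : {linear U -> H} := HB.pack F (GRing.isLinear.Build _ _ _ _ F Fl).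
have Fc : continuous F.
  by apply: (bounded_additive_continuous _ M0 FM) => x y; exact: (linearB ctrl).
have embN x : `|emb x| = `|r x| by [].
have embD : dense (range emb).
  move=> O O0 oO; have [x [Ox [z h]]] := main_op_dense phi_schur mod O0 oO.
  by exists x; split=> //; exists (x - z) => //; exact: re.
have mainE x z : main_op S (x, z) -> main x = emb z.
  by move=> /re h; rewrite /= /m -[X in _ - X]h rB opprB addrC subrK.
have ABE x u z : AB_op S ((x, u), z) -> emb z = main x + ctrl u.
  move=> [y h]; have [t ht] := hF u.
  have /re : main_op S (x - F u, z - F u).
    exists (y - t); have := Ss_sub phi_schur mod h ht; by rewrite subrr scale1r.
  rewrite opprB addrA subrK rB /= /m => e.
  by rewrite -[F u](subKr x) -e; apply: hdot_ext => v; rewrite !hdotE; ring.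
by constructor; exact: (@Extrapolation _ _ _ _ S 1 h1 H emb embN embD main mc mainE ctrl Fc ABE).
Qed.

End PassiveNode.

(** * The Cayley transform for an arbitrary extrapolation space *)

Section CayleyOfNode.
Variables (R : realType) (U Y : hilbertType R).
Local Notation C := (Cplx R).
Variable phi : C -> {linear U -> Y}.
Hypothesis phi_schur : schur_rhp phi.
Variables (H : hilbertType R) (f : H -> C -> Y) (g : H -> C -> U).
Hypothesis mod : rhp_model phi f g.
Local Notation S := (Ss phi f g).
Local Notation scale a := (sqrtC (2 * 'Re a)).
Variable E : extrapolation S.

(** On the domain of A, (a - A_{-1}) w has norm |w + (a - b) r w|, where r = (b - A)^-1; by density
    and continuity this extends to x. Hence x = (b - a) r x lies in the domain and A x = a x, which
    dissipativity excludes unless x = 0. *)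
Lemma ext_main_inj (a : C) x : rhp a -> a *: ext_emb E x = ext_main E x -> x = 0.
Proof.
move=> ha ax; have hb := ext_beta_rhp E; set b := ext_beta E in hb *.
pose r := resolvent (main_op S) b.
have rl : linear r by exact: (resolvent_linear phi_schur mod).
pose G w := w + (a - b) *: r w.
pose L w := a *: ext_emb E w - ext_main E w.
have Gc : continuous G.
  move=> w; apply: cvgD; first exact: cvg_id.
  by apply: cvgZl_tmp; exact: (resolvent_continuous phi_schur mod).
have embc : continuous (ext_emb E).
  apply: (@bounded_additive_continuous _ _ _ _ ('Re b)^-1) => [y z||y].
  - exact: linearB.
  - by rewrite invr_ge0 ltW.
  - by rewrite ext_norm; exact: (resolvent_le phi_schur mod).
have Lc : continuous L.
  move=> w; apply: cvgB; last exact: ext_main_cont.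
  by apply: cvgZl_tmp; exact: embc.
have LG w z : main_op S (w, z) -> `|L w| = `|G w|.
  move=> h; rewrite /L (ext_mainE E h) -linearZ -linearB/= ext_norm -/b -/r.
  have rE := resolvent_eq phi_schur mod hb h.
  have -> : a *: w - z = (a - b) *: w + (b *: w - z).
    by rewrite scalerBl addrA subrK.
  by rewrite rl /r rE addrC.
have Gx : G x = 0.
  apply/eqP; rewrite -normr_eq0 eq_le normr_ge0 andbT; apply/ler_addgt0Pr => e e0.
  have e2 : 0 < e / 2 by rewrite divr_gt0.
  have nx : \forall w \near x, `|L x - L w| < e / 2 /\ `|G x - G w| < e / 2.
    apply: filterI; first exact: (@cvgr_dist_lt _ _ _ (nbhs x) _ L (L x) (Lc x) _ e2).
    exact: (@cvgr_dist_lt _ _ _ (nbhs x) _ G (G x) (Gc x) _ e2).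
  have [w [/interior_subset[h1 h2] [z h]]] :
    (interior [set w | `|L x - L w| < e / 2 /\ `|G x - G w| < e / 2] `&`
      [set w | exists z, main_op S (w, z)]) !=set0.
    by apply: (main_op_dense phi_schur mod); [exists x | exact: open_interior].
  have Lx : L x = 0 by rewrite /L ax subrr.
  move: h1; rewrite Lx sub0r normrN (LG _ _ h) => h1.
  have -> : G x = (G x - G w) + G w by rewrite subrK.
  by rewrite add0r (splitr e) (le_trans (ler_normD _ _))// lerD// ltW.
have [z h e] := resolventP phi_schur mod x hb; rewrite -/r in h e.
have xr : (b - a) *: r x = x.
  by rewrite -opprB scaleNr -[RHS]subr0 -{1}Gx /G opprD addrA subrr add0r.
have := main_op_Z phi_schur mod (b - a) h; rewrite xr => hx.
apply: (resolvent_unique phi_schur mod ha hx).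
have -> : z = b *: r x - x by rewrite -[X in _ - X]e subKr.
by rewrite scalerBr scalerA mulrC -scalerA xr scalerBl opprB addrC subrK.
Qed.

(** The vector from [Ss_input] solves the equation that defines [ext_input], and injectivity makes
    it the only solution. *)
Lemma ext_inputP (a : C) u : rhp a ->
  exists y, S ((ext_input E a u, u), (a *: ext_input E a u, y)).
Proof.
move=> ha; have [F [_ _ hF]] := Ss_input phi_schur mod ha.
have [y h] := hF u; exists y.
have hE : a *: ext_emb E (F u) - ext_main E (F u) = ext_ctrl E u.
  by have /(ext_ABE E) := ex_intro _ y h : AB_op S ((F u, u), a *: F u); rewrite linearZ/= => ->;
    rewrite addrC addKr.
rewrite /ext_input; case: xgetP => [w _ hw|/(_ (F u))//].
suff -> : w = F u by [].
apply/eqP; rewrite -subr_eq0; apply/eqP; apply: (ext_main_inj ha).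
rewrite !linearB/= ?scalerBr; move/eqP: hE; rewrite subr_eq => /eqP ->.
move: hw => /= /eqP; rewrite subr_eq => /eqP ->.
by rewrite opprD addrACA subrr add0r.
Qed.

Lemma pfun_at_eq (V W : pointedType) (P : set (V * W)) v w :
  single_valued P -> P (v, w) -> pfun_at P v = w.
Proof.
move=> sP Pvw; rewrite /pfun_at; case: xgetP => [w' _ h|/(_ w)//].
exact: sP h Pvw.
Qed.

Lemma cayley_rel_state (a : C) x : rhp a ->
  cayley_rel phi f g a (x, 0) (cayleyA S a x, cayleyC S a x).
Proof.
move=> ha; have [T uT hT] := cayley_rel_unitary phi_schur mod ha.
have c0 : scale a != 0 by rewrite lt0r_neq0// cayley_scale_gt0.
have sv := Ss_single_valued phi_schur mod.
have [z [y h] e] := resolventP phi_schur mod x ha.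
have -> : cayleyA S a x = a^* *: resolvent (main_op S) a x + z.
  congr (_ + _); apply: pfun_at_eq; last by exists y.
  by move=> v t t' [s hs] [s' hs']; have [] := sv _ _ _ hs hs'.
have -> : cayleyC S a x = scale a *: y.
  congr (_ *: _); apply: pfun_at_eq; last by exists z.
  by move=> v t t' [s hs] [s' hs']; have [] := sv _ _ _ hs hs'.
move: h => /(Ss_cayley_rel mod _ _ _ _ ha); rewrite e => /hT h; apply/hT.
(* [Ss_cayley_rel] supplies the relation for x / c; linearity of [T] removes the factor. *)
have -> : (x, 0) = scale a *: (((scale a)^-1 *: x, 0) : dsum H U) + 0.
  by rewrite addr0; congr pair; rewrite /= ?scaler0// scalerA divff// scale1r.
have [lT _ _] := uT; rewrite lT -h.
by rewrite (unitary0 uT) addr0; congr pair; rewrite /= scalerA divff// scale1r.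
Qed.

Lemma cayley_rel_input (a : C) u : rhp a ->
  cayley_rel phi f g a (0, u) (cayleyB E a u, cayleyD E a u).
Proof.
move=> ha; have [y h] := ext_inputP u ha.
have c0 : scale a != 0 by rewrite lt0r_neq0// cayley_scale_gt0.
have sv := Ss_single_valued phi_schur mod.
have -> : cayleyD E a u = y by rewrite /cayleyD /transfer (pfun_at_eq sv h).
move: h => /(Ss_cayley_rel mod _ _ _ _ ha); rewrite subrr scaler0.
by rewrite -scalerDl addrC -cayley_scale_sqr scalerA mulrA mulVf// mul1r.
Qed.

Lemma cayley_unitary (a : C) : rhp a -> unitary_op (cayley E a).
Proof.
move=> ha; have [T uT hT] := cayley_rel_unitary phi_schur mod ha.
suff -> : cayley E a = T by [].
apply/funext => -[x u].
have -> : T (x, u) = T (x, 0) + T (0, u).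
  have [lT _ _] := uT; rewrite -[T (x, 0)]scale1r -lT scale1r.
  by congr T; congr pair; rewrite /= ?addr0 ?add0r.
have /hT <- := cayley_rel_state x ha.
by have /hT <- := cayley_rel_input u ha.
Qed.

End CayleyOfNode.

(** * Transfer from the disk *)

Section ExtendAt.
Variables (R : realType) (V : normedModType (Cplx R)).
Local Notation C := (Cplx R).

Lemma extend_at_eq0 a (F : C -> V) z : (forall w, F w = 0) -> extend_at a F z = 0.
Proof.
move=> F0; have -> : F = (fun=> 0) by apply/funext.
rewrite /extend_at; case: ifP => // _.
by apply: cvg_lim; [exact: norm_hausdorff | exact: (@cvg_cst V 0 C a^')].
Qed.

Lemma extend_at_on (D : set C) a (F G : C -> V) :
  (\forall w \near a^', D w /\ w != a) ->
  (forall w, D w -> w != a -> F w = G w) -> G w @[w --> a] --> G a ->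
  forall z, D z -> extend_at a F z = G z.
Proof.
move=> nD FG Gc z Dz; have [->|za] := eqVneq z a; last by rewrite extend_at_neq// FG.
by apply: extend_at_lim Gc; apply: filterS nD => w [Dw wa]; exact: FG.
Qed.

End ExtendAt.

Section RkhsModel.
Variables (R : realType) (U Y : hilbertType R).
Local Notation C := (Cplx R).
Variable phi : C -> {linear U -> Y}.
Hypothesis phi_schur : schur_rhp phi.

(** Test vectors (v, 0) and (0, w) separate the columns of the kernel; the point 1 fills the
    variable that the component at hand does not see. *)
Lemma rkhs_rhp_model (H : hilbertType R) (f : H -> C -> Y) (g : H -> C -> U) :
  is_rkhs (@rhp R `*` @rhp R) (split_eval f g) (Ks phi) -> rhp_model phi f g.
Proof.
have h1 := @rhp1 R; move=> [lin ext ker]; split.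
- by move=> m hm c x y; have := lin (m, 1) (conj hm h1) c x y => /(congr1 fst).
- by move=> m hm c x y; have := lin (1, m) (conj h1 hm) c x y => /(congr1 snd).
- move=> x fx gx; apply: ext => -[m n] [/= hm hn].
  by rewrite /split_eval/= fx// gx.
- move=> l v hl; have [k [kE kx]] := ker (l, 1) (v, 0) (conj hl h1).
  exists k; split=> [m hm|m hm ml|x].
  + have /(congr1 fst)/= := kE (m, 1) (conj hm h1); rewrite /split_eval/= => ->.
    rewrite extend_at_eq0 ?addr0// => t.
    by rewrite [phi 1^* 0]linear0 [phi t 0]linear0 subrr scaler0.
  + have /(congr1 snd)/= := kE (1, m) (conj h1 hm); rewrite /split_eval/= => ->.
    rewrite extend_at_neq// /Kc (adjoint_tilde phi_schur)// linear0.
    rewrite tilde_0 subrr scaler0 addr0.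
    by rewrite {1}/tilde conjCK.
  + by rewrite kx dsum_hdotE/= hdot0r addr0.
- move=> l w hl; have [k [kE kx]] := ker (1, l) (0, w) (conj h1 hl).
  exists k; split=> [m hm ml|m hm|x].
  + have /(congr1 fst)/= := kE (m, 1) (conj hm h1); rewrite /split_eval/= => ->.
    rewrite extend_at_neq// adjoint0 [phi m 0]linear0.
    by rewrite subrr scaler0 add0r.
  + have /(congr1 snd)/= := kE (1, m) (conj h1 hm); rewrite /split_eval/= => ->.
    rewrite extend_at_eq0 ?add0r /Kc ?(adjoint_tilde phi_schur)// => t.
    by rewrite /tilde !adjoint0 subrr scaler0.
  + by rewrite kx dsum_hdotE/= hdot0r add0r.
Qed.

End RkhsModel.

Section Mobius.
Variable R : realType.
Local Notation C := (Cplx R).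
Implicit Types a m z : C.

Lemma disk_add1_neq0 z : disk z -> 1 + z != 0.
Proof.
move=> hz; apply/eqP => /eqP; rewrite addrC addr_eq0 => /eqP z1.
by move: hz; rewrite /disk/= z1 normrN1 ltxx.
Qed.

Lemma disk0 : disk (0 : C).
Proof. by rewrite /disk/= normr0 ltr01. Qed.

Lemma disk_conj z : disk z -> disk z^*.
Proof. by rewrite /disk/= norm_conjC. Qed.

Lemma near_disk0 : \forall z \near (0 : C)^', disk z /\ z != 0.
Proof.
apply: filterI; last exact: (@withinT C (nbhs (0 : C))).
apply: (@cvg_within _ (nbhs (0 : C))).
have := @nbhsx_ballx C C 0 1 ltr01; apply: filterS => z.
by rewrite -ball_normE/= sub0r normrN.
Qed.

Lemma mobius_inv_disk a m : rhp a -> rhp m -> disk (mobius_inv a m).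
Proof.
move=> ha hm; rewrite /disk/= /mobius_inv normrM normfV.
have n0 := rhp_add_neq0 (rhp_conj ha) hm.
rewrite ltr_pdivrMr ?normr_gt0// mul1r -(@ltr_pXn2r _ 2) ?nnegrE// !normCK.
rewrite -subr_gt0 rmorphD rmorphB/= conjCK.
have -> : (a^* + m) * (a + m^*) - (a - m) * (a^* - m^*) = (a + a^*) * (m + m^*) by ring.
by rewrite mulr_gt0 ?rhp_addC_gt0.
Qed.

Lemma mobius_rhp a z : rhp a -> disk z -> rhp (mobius a z).
Proof.
move=> ha hz; have n0 := disk_add1_neq0 hz.
have n1 : 1 + z^* != 0 by exact: disk_add1_neq0 (disk_conj hz).
rewrite /rhp/= -(@pmulr_rgt0 _ 2)// twice_Re /mobius fmorph_div/=.
rewrite rmorphB rmorphD rmorphM/= conjCK rmorph1.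
have -> : (a - a^* * z) / (1 + z) + (a^* - a * z^*) / (1 + z^*) =
    (a + a^*) * (1 - z * z^*) / ((1 + z) * (1 + z)^*).
  by rewrite rmorphD rmorph1/=; field; rewrite n0 n1.
rewrite -!normCK divr_gt0 ?exprn_gt0 ?normr_gt0//.
rewrite mulr_gt0 ?rhp_addC_gt0// subr_gt0.
by rewrite -[X in _ < X](expr1n _ 2) ltr_pXn2r ?nnegrE ?ler01.
Qed.

Lemma mobiusK a z : rhp a -> disk z -> mobius_inv a (mobius a z) = z.
Proof.
move=> ha hz; have n0 := disk_add1_neq0 hz.
have na : a + a^* != 0 by rewrite lt0r_neq0// rhp_addC_gt0.
rewrite /mobius_inv /mobius; field.
rewrite n0 /=; have -> : a^* * (1 + z) + (a - a^* * z) = a + a^* by ring.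
by [].
Qed.

Lemma mobius_invK a m : rhp a -> rhp m -> mobius a (mobius_inv a m) = m.
Proof.
move=> ha hm; have n0 := rhp_add_neq0 (rhp_conj ha) hm.
have na : a + a^* != 0 by rewrite lt0r_neq0// rhp_addC_gt0.
rewrite /mobius_inv /mobius; field.
rewrite n0 /=; have -> : a^* + m + (a - m) = a + a^* by ring.
by [].
Qed.

Lemma mobius_conj a z : (mobius a z)^* = mobius a^* z^*.
Proof. by rewrite /mobius fmorph_div/= rmorphB rmorphD rmorphM rmorph1. Qed.

Lemma mobius_inv_conj a m : (mobius_inv a m)^* = mobius_inv a^* m^*.
Proof. by rewrite /mobius_inv fmorph_div/= rmorphB rmorphD. Qed.

Lemma mobius0 a : mobius a 0 = a.
Proof. by rewrite /mobius mulr0 subr0 addr0 divr1. Qed.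

Lemma mobius_inv_at a : mobius_inv a a = 0.
Proof. by rewrite /mobius_inv subrr mul0r. Qed.

Lemma mobius_cvg0 a : mobius a z @[z --> (0 : C)] --> (a : C^o).
Proof.
have cst (b : C) : b @[z --> (0 : C)] --> (b : C^o) by exact: (@cvg_cst C^o b C (nbhs (0 : C))).
have id : z @[z --> (0 : C)] --> (0 : C^o) by exact: cvg_id.
have num : a - a^* * z @[z --> (0 : C)] --> (a - a^* * 0 : C^o).
  apply: (@cvgB C C^o C (nbhs (0 : C)) _ (fun=> a) (fun z => a^* * z) _ _ (cst a)).
  exact: (@cvgM C C (nbhs (0 : C)) _ (fun=> a^*) (fun z => z) _ _ (cst a^*) id).
have den : 1 + z @[z --> (0 : C)] --> (1 + 0 : C^o).
  exact: (@cvgD C C^o C (nbhs (0 : C)) _ (fun=> 1) (fun z => z) _ _ (cst 1) id).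
have n0 : 1 + 0 != 0 :> C by rewrite addr0 oner_eq0.
have key (l : C) : l = a -> mobius a z @[z --> (0 : C)] --> (l : C^o) ->
    mobius a z @[z --> (0 : C)] --> (a : C^o) by move=> ->.
apply: (key ((a - a^* * 0) * (1 + 0)^-1)); first by rewrite mulr0 subr0 addr0 invr1 mulr1.
exact: (@cvgM C C (nbhs (0 : C)) _ (fun z => a - a^* * z) (fun z => (1 + z)^-1) _ _ num
  (@cvgV C C (nbhs (0 : C)) _ (fun z => 1 + z) _ n0 den)).
Qed.

End Mobius.

(** * The disk space as a model on the half-plane *)

Section DiskModel.
Variables (R : realType) (U Y : hilbertType R).
Local Notation C := (Cplx R).
Variable phi : C -> {linear U -> Y}.
Hypothesis phi_schur : schur_rhp phi.
Local Notation scale a := (sqrtC (2 * 'Re a)).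
Variables (a : C) (ha : rhp a).
Let phid z := phi (mobius a z).

(** Here p, q, n stand for a, conj a, conj l. Conjugates are made independent variables, so that
    exchanging p and q covers the second component. *)
Lemma cayley_szego (F : fieldType) (p q c m n : F) : c * c = p + q -> c != 0 ->
  q + m != 0 -> p + n != 0 -> m + n != 0 ->
  c / (q + m) * (c / (p + n) * (1 - (p - m) / (q + m) * ((q - n) / (p + n)))^-1) = (m + n)^-1.
Proof.
move=> c2 c0 h1 h2 h3.
have -> : 1 - (p - m) / (q + m) * ((q - n) / (p + n)) =
    c * c * (m + n) / ((q + m) * (p + n)) by rewrite c2; field; rewrite h1 h2.
by field; rewrite h1 h2 h3 c0.
Qed.

(** The minus sign accounts for the opposite order of the differences in [Kdisk] and [Ks]. *)
Lemma cayley_difference (F : fieldType) (p q c m n : F) : c * c = p + q -> c != 0 ->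
  p + m != 0 -> p + n != 0 -> m != n ->
  c / (p + m) * (c / (p + n) * ((q - m) / (p + m) - (q - n) / (p + n))^-1) = - (m - n)^-1.
Proof.
move=> c2 c0 h1 h2 h3; have h4 : m - n != 0 by rewrite subr_eq0.
have -> : (q - m) / (p + m) - (q - n) / (p + n) =
    c * c * - (m - n) / ((p + m) * (p + n)) by rewrite c2; field; rewrite h1 h2.
by field; rewrite oppr_eq0 h1 h2 h4 c0.
Qed.

Section Transfer.
Variables (B : hilbertType R) (b1 : B -> C -> Y) (b2 : B -> C -> U).
Hypothesis b_rkhs : is_rkhs (@disk R) (fun x z => (b1 x z, b2 x z) : dsum Y U) (Kdisk phid).

(** The first component of Xi, taken as an evaluation on the disk space itself. *)
Definition rhp_of_disk1 x m := (scale a / (a^* + m)) *: b1 x (mobius_inv a m).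
Definition rhp_of_disk2 x m := (scale a / (a + m)) *: b2 x (mobius_inv a^* m).

Lemma disk_linear1 z : disk z -> linear (b1 ^~ z).
Proof. by case: b_rkhs => lin _ _ hz c x y; have := lin z hz c x y => /(congr1 fst). Qed.

Lemma disk_linear2 z : disk z -> linear (b2 ^~ z).
Proof. by case: b_rkhs => lin _ _ hz c x y; have := lin z hz c x y => /(congr1 snd). Qed.

Lemma disk_Z1 z c x : disk z -> b1 (c *: x) z = c *: b1 x z.
Proof.
move=> hz; have h := disk_linear1 hz.
have h0 : b1 0 z = 0 by have := h (-1) 0 0; rewrite scaler0 addr0 scaleN1r addNr.
by rewrite -[c *: x]addr0 h h0 addr0.
Qed.

Lemma disk_Z2 z c x : disk z -> b2 (c *: x) z = c *: b2 x z.
Proof.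
move=> hz; have h := disk_linear2 hz.
have h0 : b2 0 z = 0 by have := h (-1) 0 0; rewrite scaler0 addr0 scaleN1r addNr.
by rewrite -[c *: x]addr0 h h0 addr0.
Qed.

Lemma disk_rhp_model : rhp_model phi rhp_of_disk1 rhp_of_disk2.
Proof.
have c0 : scale a != 0 by rewrite lt0r_neq0// cayley_scale_gt0.
have cc := cayley_scale_conj ha; have c2 := cayley_scale_sqr a.
have hac := rhp_conj ha.
have n1 m : rhp m -> a^* + m != 0 by exact: rhp_add_neq0.
have n2 m : rhp m -> a + m != 0 by exact: rhp_add_neq0.
have [_ ext ker] := b_rkhs; split.
- move=> m hm c x y; rewrite /rhp_of_disk1 (disk_linear1 (mobius_inv_disk ha hm)).
  by rewrite scalerDr !scalerA mulrC.
- move=> m hm c x y; rewrite /rhp_of_disk2 (disk_linear2 (mobius_inv_disk hac hm)).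
  by rewrite scalerDr !scalerA mulrC.
- move=> x fx gx; apply: ext => z hz; congr pair.
    have hm := mobius_rhp ha hz; have := fx _ hm; rewrite /rhp_of_disk1 mobiusK//.
    by move/eqP; rewrite scaler_eq0 mulf_eq0 invr_eq0 (negbTE c0) (negbTE (n1 _ hm)) => /eqP.
  have hm := mobius_rhp hac hz; have := gx _ hm; rewrite /rhp_of_disk2 mobiusK//.
  by move/eqP; rewrite scaler_eq0 mulf_eq0 invr_eq0 (negbTE c0) (negbTE (n2 _ hm)) => /eqP.
- move=> l v hl; have hw := mobius_inv_disk ha hl; set w := mobius_inv a l in hw.
  have hlc := rhp_conj hl; have [k [kE kx]] := ker w (v, 0) hw.
  (* The conjugate of the weight turns the reproducing property of [k] into that of the weighted
     evaluation. *)
  exists ((scale a / (a^* + l))^* *: k); split=> [m hm|m hm ml|x].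
  + have hz := mobius_inv_disk ha hm; rewrite /rhp_of_disk1 disk_Z1//.
    have /(congr1 fst)/= -> := kE _ hz.
    rewrite extend_at_eq0 => [|t]; last first.
      by rewrite [phid w^* 0]linear0 [phid t 0]linear0 subrr scaler0.
    rewrite addr0 /phid mobius_invK// /w mobius_invK// mobius_inv_conj /mobius_inv.
    rewrite !scalerA; congr (_ *: _).
    rewrite fmorph_div/= cc rmorphD/= conjCK.
    have n3 := n2 _ hlc; have n4 := n1 _ hm; have n5 := rhp_add_neq0 hm hlc.
    rewrite -mulrA; exact: (cayley_szego c2 c0 n4 n3 n5).
  + have hz := mobius_inv_disk hac hm; rewrite /rhp_of_disk2 disk_Z2//.
    have /(congr1 snd)/= -> := kE _ hz.
    rewrite [phid w^* 0]linear0 adjoint0 subrr scaler0 addr0.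
    have zw : mobius_inv a^* m != w^*.
      rewrite /w mobius_inv_conj; apply: contra ml => /eqP e.
      by rewrite -(mobius_invK hac hm) e mobius_invK.
    rewrite extend_at_neq// /phid /w mobius_invK//.
    have -> : mobius a (mobius_inv a^* m)^* = m^*.
      by rewrite mobius_inv_conj conjCK mobius_invK//; exact: rhp_conj.
    rewrite -/(tilde phi m v) mobius_inv_conj /mobius_inv conjCK.
    rewrite !scalerA fmorph_div/= cc rmorphD/= conjCK -mulrA.
    rewrite (cayley_difference c2 c0 (n2 _ hm) (n2 _ hlc) ml).
    by rewrite scaleNr -scalerN opprB.
  + by rewrite hdotZr conjCK kx dsum_hdotE/= hdot0r addr0 /rhp_of_disk1 hdotZl.
- move=> l v hl; have hw := mobius_inv_disk hac hl; set w := mobius_inv a^* l in hw.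
  have hlc := rhp_conj hl; have [k [kE kx]] := ker w (0, v) hw.
  exists ((scale a / (a + l))^* *: k); split=> [m hm ml|m hm|x].
  + have hz := mobius_inv_disk ha hm; rewrite /rhp_of_disk1 disk_Z1//.
    have /(congr1 fst)/= -> := kE _ hz.
    rewrite adjoint0 [phid _ 0]linear0 subrr scaler0 add0r.
    have wE : w^* = mobius_inv a l^* by rewrite /w mobius_inv_conj conjCK.
    have zw : mobius_inv a m != w^*.
      by rewrite wE; apply: contra ml => /eqP e; rewrite -(mobius_invK ha hm) e mobius_invK.
    rewrite extend_at_neq// /phid wE !mobius_invK//.
    rewrite /mobius_inv.
    rewrite !scalerA fmorph_div/= cc rmorphD/= -mulrA.
    have c2' : scale a * scale a = a^* + a by rewrite addrC.
    rewrite (cayley_difference c2' c0 (n1 _ hm) (n1 _ hlc) ml).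
    by rewrite scaleNr -scalerN opprB.
  + have hz := mobius_inv_disk hac hm; rewrite /rhp_of_disk2 disk_Z2//.
    have /(congr1 snd)/= -> := kE _ hz.
    rewrite extend_at_eq0 => [|t]; last by rewrite !adjoint0 subrr scaler0.
    rewrite add0r.
    have wE : w^* = mobius_inv a l^* by rewrite /w mobius_inv_conj conjCK.
    have -> : phid w^* v = phi l^* v by rewrite /phid wE mobius_invK.
    have -> : adjoint (phid (mobius_inv a^* m)^*) (phi l^* v) = tilde phi m (phi l^* v).
      by rewrite /phid mobius_inv_conj conjCK mobius_invK//; exact: rhp_conj.
    rewrite wE /mobius_inv !scalerA; congr (_ *: _).
    rewrite fmorph_div/= cc rmorphD/= conjCK; have n5 := rhp_add_neq0 hm hlc.
    have c2' : scale a * scale a = a^* + a by rewrite addrC.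
    rewrite -mulrA; exact: (cayley_szego c2' c0 (n2 _ hm) (n1 _ hlc) n5).
  + by rewrite hdotZr conjCK kx dsum_hdotE/= hdot0r add0r /rhp_of_disk2 hdotZl.
Qed.

End Transfer.
End DiskModel.

(** * Formulas for the four blocks *)

Section CayleyValues.
Variables (R : realType) (U Y : hilbertType R).
Local Notation C := (Cplx R).
Variable phi : C -> {linear U -> Y}.
Hypothesis phi_schur : schur_rhp phi.
Variables (H : hilbertType R) (f : H -> C -> Y) (g : H -> C -> U).
Hypothesis mod : rhp_model phi f g.
Local Notation scale a := (sqrtC (2 * 'Re a)).
Variables (a : C) (ha : rhp a).

Lemma cayley_output (p : dsum H U) (q : dsum H Y) : cayley_rel phi f g a p q ->
  q.2 = scale a *: f p.1 a + phi a p.2.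
Proof.
move=> h; have [+ _] := h a ha; rewrite subrr scale0r [a^* + a]addrC -cayley_scale_sqr => e.
have c0 : scale a != 0 by rewrite lt0r_neq0// cayley_scale_gt0.
apply: (scalerI c0); apply/eqP; rewrite -subr_eq0; apply/eqP.
move/(congr1 -%R): e; rewrite oppr0 => ->.
by apply: hdot_ext => v; rewrite !hdotE; ring.
Qed.

(** The factor [s] is 1 for the state block and the inverse of the scale for the input block, whose
    formula keeps the scale outside the extension. *)
Lemma cayley_value1 (s : C) (F : C -> Y) (p : dsum H U) (q : dsum H Y) m :
  cayley_rel phi f g a p q -> rhp m ->
  (forall t, rhp t -> t != a -> F t = s *: ((a - t)^-1 *:
     ((a^* + t) *: f p.1 t - scale a *: q.2 + scale a *: phi t p.2))) ->
  extend_at a F m = s *: f q.1 m.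
Proof.
move=> h hm FE; apply: (@extend_at_on _ _ (@rhp R) a F (fun t => s *: f q.1 t)) => //.
- exact: dnbhs_rhp.
- move=> w hw wa; have [e _] := h w hw.
  rewrite FE// -e (scalerA _ (a - w)) mulVf ?scale1r//.
  by rewrite subr_eq0 eq_sym.
- exact: (@cvgZl_tmp C Y C (nbhs a) _ s (f q.1) _ (model_continuous1 phi_schur mod ha)).
Qed.

Lemma cayley_value2 (p : dsum H U) (q : dsum H Y) m : cayley_rel phi f g a p q -> rhp m ->
  g q.1 m = (a + m)^-1 *:
    ((a^* - m) *: g p.1 m - scale a *: tilde phi m q.2 + scale a *: p.2).
Proof.
move=> h hm; have [_ <-] := h m hm.
by rewrite scalerA mulVf ?scale1r// rhp_add_neq0.
Qed.

Variable E : extrapolation (Ss phi f g).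

Lemma cayleyCE x : cayleyC (Ss phi f g) a x = scale a *: f x a.
Proof.
by have /cayley_output/= -> := cayley_rel_state phi_schur mod x ha; rewrite linear0 addr0.
Qed.

Lemma cayleyDE u : cayleyD E a u = phi a u.
Proof.
have /cayley_output/= -> := cayley_rel_input phi_schur mod E u ha.
by rewrite -(scale0r (0 : H)) (model_Z1 mod)// scale0r scaler0 add0r.
Qed.

Lemma cayleyAE x m : rhp m.1 -> rhp m.2 ->
  split_eval f g (cayleyA (Ss phi f g) a x) m = model_cayleyA phi a (f x) (g x) m.
Proof.
move=> h1 h2; have h := cayley_rel_state phi_schur mod x ha.
congr pair.
  rewrite -[LHS]scale1r; apply/esym; apply: (cayley_value1 h h1) => t ht ta /=.
  rewrite [phi t 0]linear0 cayleyCE !scalerA cayley_scale_sqr twice_Re.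
  by apply: hdot_ext => v; rewrite !hdotE hdot0l; ring.
have /= -> := cayley_value2 h h2.
rewrite cayleyCE (tilde_Z phi_schur)// scaler0 addr0 !scalerA cayley_scale_sqr twice_Re.
by apply: hdot_ext => v; rewrite !hdotE; ring.
Qed.

Lemma cayleyBE u m : rhp m.1 -> rhp m.2 ->
  split_eval f g (cayleyB E a u) m = model_cayleyB phi a u m.
Proof.
move=> h1 h2; have h := cayley_rel_input phi_schur mod E u ha.
have zero t : rhp t -> f 0 t = 0 /\ g 0 t = 0.
  by move=> ht; rewrite -[0 : H](scale0r 0) (model_Z1 mod)// (model_Z2 mod)// !scale0r.
congr pair.
  have c0 : scale a != 0 by rewrite lt0r_neq0// cayley_scale_gt0.
  rewrite /= (cayley_value1 (s := (scale a)^-1) h h1) => [|t ht ta /=].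
    by rewrite scalerA divff// scale1r.
  have [-> _] := zero _ ht; have ta' : a - t != 0 by rewrite subr_eq0 eq_sym.
  by rewrite cayleyDE; apply: hdot_ext => v; rewrite !hdotE hdot0l; field; rewrite c0 ta'.
have /= -> := cayley_value2 h h2; have [_ ->] := zero _ h2.
rewrite cayleyDE /Kc (adjoint_tilde phi_schur (rhp_conj ha)) conjCK scaler0 sub0r.
by rewrite [m.2 + a]addrC; apply: hdot_ext => v; rewrite !hdotE; ring.
Qed.

End CayleyValues.

Lemma unitary_dsum_id (R : realType) (X X' W : hilbertType R) (T : X -> X') :
  unitary_op T -> unitary_op ((fun w => (T w.1, w.2)) : dsum X W -> dsum X' W).
Proof.
move=> [lT iT sT]; split=> [c v w|v w|[z w]].
- by congr pair; exact: lT.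
- by rewrite !dsum_hdotE/= iT.
- by have [x <-] := sT z; exists (x, w).
Qed.

Section DiskSimilarity.
Variables (R : realType) (U Y : hilbertType R).
Local Notation C := (Cplx R).
Variable phi : C -> {linear U -> Y}.
Hypothesis phi_schur : schur_rhp phi.
Local Notation scale a := (sqrtC (2 * 'Re a)).
Variables (a : C) (ha : rhp a).
Let phid z := phi (mobius a z).
Variables (B : hilbertType R) (b1 : B -> C -> Y) (b2 : B -> C -> U).
Hypothesis b_rkhs : is_rkhs (@disk R) (fun x z => (b1 x z, b2 x z) : dsum Y U) (Kdisk phid).
Variables (H : hilbertType R) (f : H -> C -> Y) (g : H -> C -> U) (Xi : B -> H).
Hypothesis f_Xi : forall x m, rhp m -> f (Xi x) m = rhp_of_disk1 a b1 x m.
Hypothesis g_Xi : forall x m, rhp m -> g (Xi x) m = rhp_of_disk2 a b2 x m.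

(** The Moebius map sends 0 to [a], so this is continuity at [a] in the half-plane model after
    removing the weight. *)
Lemma disk_continuous0 x : b1 x z @[z --> (0 : C)] --> b1 x 0.
Proof.
have c0 : scale a != 0 by rewrite lt0r_neq0// cayley_scale_gt0.
have hac := rhp_conj ha.
pose F z := ((scale a)^-1 * (a^* + mobius a z)) *: rhp_of_disk1 a b1 x (mobius a z).
have FE z : disk z -> b1 x z = F z.
  move=> hz; rewrite /F /rhp_of_disk1 scalerA mobiusK//.
  have n0 := rhp_add_neq0 hac (mobius_rhp ha hz).
  by rewrite (_ : _ * _ = 1) ?scale1r//; field; rewrite c0 n0.
have mod := disk_rhp_model ha b_rkhs.
have mc := @mobius_cvg0 R a.
have Fc : F z @[z --> (0 : C)] --> F 0.
  have c1 : rhp_of_disk1 a b1 x (mobius a z) @[z --> (0 : C)] -->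
      rhp_of_disk1 a b1 x (mobius a 0).
    rewrite mobius0.
    exact: (cvg_comp (mobius a) (rhp_of_disk1 a b1 x) mc (model_continuous1 phi_schur mod ha)).
  have c2 : (scale a)^-1 * (a^* + mobius a z) @[z --> (0 : C)] -->
      ((scale a)^-1 * (a^* + mobius a 0) : C^o).
    have cst (b : C) : b @[z --> (0 : C)] --> (b : C^o).
      exact: (@cvg_cst C^o b C (nbhs (0 : C))).
    have c3 : a^* + mobius a z @[z --> (0 : C)] --> (a^* + a : C^o).
      exact: (@cvgD C C^o C (nbhs (0 : C)) _ (fun=> a^*) (mobius a) _ _ (cst a^*) mc).
    rewrite mobius0.
    exact: (@cvgM C C (nbhs (0 : C)) _ (fun=> (scale a)^-1) (fun z => a^* + mobius a z)
      _ _ (cst (scale a)^-1) c3).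
  exact: (@cvgZ C Y C (nbhs (0 : C)) _ _ _ _ _ c2 c1).
rewrite (FE _ (disk0 R)).
apply: cvg_trans Fc => N /= FN.
have nD : \forall z \near (0 : C), disk z.
  have := @nbhsx_ballx C C 0 1 ltr01; apply: filterS => z.
  by rewrite -ball_normE/= sub0r normrN.
by apply: filterS2 nD FN => z hz /=; rewrite FE.
Qed.

(** Dividing [cayley_rel] by a + m or conj a + m turns its Moebius quotients into z; only the common
    scale is left to cancel. *)
Lemma disk_relation (h k : B) u y :
  cayley_rel phi f g a (Xi h, u) (Xi k, y) -> forall z, disk z ->
  z *: b1 k z = b1 h z - y + phid z u /\
  b2 k z = z *: b2 h z - adjoint (phid z^*) y + u.
Proof.
move=> rel z hz; have hac := rhp_conj ha.
have c0 : scale a != 0 by rewrite lt0r_neq0// cayley_scale_gt0.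
split; apply: (scalerI c0).
- have hm := mobius_rhp ha hz; have [/= + _] := rel _ hm.
  rewrite !f_Xi// /rhp_of_disk1 mobiusK// => e.
  have n0 := rhp_add_neq0 hac hm.
  have zE : z = (a - mobius a z) / (a^* + mobius a z) by exact/esym/mobiusK.
  move: e; set m := mobius a z in zE n0 *.
  have -> : (a - m) *: ((scale a / (a^* + m)) *: b1 k z) = scale a *: (z *: b1 k z).
    by rewrite {2}zE !scalerA; congr (_ *: _); field.
  move=> ->; apply: hdot_ext => v; rewrite !hdotE -/(phid z); field.
  by [].
- have hm := mobius_rhp hac hz; have [_ /=] := rel _ hm.
  rewrite !g_Xi// /rhp_of_disk2 mobiusK// => e.
  have n0 : a + mobius a^* z != 0 by rewrite rhp_add_neq0.
  have zE : z = (a^* - mobius a^* z) / (a + mobius a^* z).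
    by rewrite -[in LHS](mobiusK hac hz) /mobius_inv conjCK.
  have tE : tilde phi (mobius a^* z) y = adjoint (phid z^*) y.
    by rewrite /tilde /phid mobius_conj conjCK.
  move: e; rewrite tE; set m := mobius a^* z in zE n0 *.
  have -> : (a + m) *: ((scale a / (a + m)) *: b2 k z) = scale a *: b2 k z.
    by rewrite !scalerA; congr (_ *: _); field.
  have -> : (a^* - m) *: ((scale a / (a + m)) *: b2 h z) = scale a *: (z *: b2 h z).
    by rewrite {2}zE !scalerA; congr (_ *: _); field.
  by move=> ->; apply: hdot_ext => v; rewrite !hdotE; ring.
Qed.

Lemma disk_extend (F : C -> Y) k z :
  (forall t, disk t -> t != 0 -> t *: b1 k t = t *: F t) -> disk z -> extend_at 0 F z = b1 k z.
Proof.
move=> FE hz; apply: (@extend_at_on _ _ (@disk R) 0 F (b1 k)) => //.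
- exact: near_disk0.
- by move=> t ht t0; apply: (scalerI t0); rewrite FE.
- exact: disk_continuous0.
Qed.

End DiskSimilarity.


Theorem proposition6p2 (R : realType) (U Y : hilbertType R)
    (U_separable : separable U) (Y_separable : separable Y)
    (phi : Cplx R -> {linear U -> Y}) (phi_schur : schur_rhp phi)
    (Hs : hilbertType R) (hs1 : Hs -> Cplx R -> Y) (hs2 : Hs -> Cplx R -> U)
    (Hs_rkhs : is_rkhs (@rhp R `*` @rhp R) (split_eval hs1 hs2) (Ks phi)) :
  passive_system_node (Ss phi hs1 hs2) /\
  inhabited (extrapolation (Ss phi hs1 hs2)) /\
  forall (E : extrapolation (Ss phi hs1 hs2)) (a : Cplx R), rhp a ->
    [/\ unitary_op (cayley E a),
        forall x m, rhp m.1 -> rhp m.2 ->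
          split_eval hs1 hs2 (cayleyA (Ss phi hs1 hs2) a x) m
            = model_cayleyA phi a (hs1 x) (hs2 x) m,
        forall u m, rhp m.1 -> rhp m.2 ->
          split_eval hs1 hs2 (cayleyB E a u) m = model_cayleyB phi a u m,
        forall x, cayleyC (Ss phi hs1 hs2) a x = sqrtC (2 * 'Re a) *: hs1 x a
      & forall u, cayleyD E a u = phi a u] /\
    forall (bHs : hilbertType R) (bh1 : bHs -> Cplx R -> Y) (bh2 : bHs -> Cplx R -> U),
    let phid := fun z => phi (mobius a z) in
    let bev := fun x z => (bh1 x z, bh2 x z) : dsum Y U in
    is_rkhs (@disk R) bev (Kdisk phid) ->
    exists (bA : bHs -> bHs) (bB : U -> bHs) (bC : bHs -> Y) (bD : U -> Y)
           (Xi : bHs -> Hs),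
      [/\
          [/\ unitary_op ((fun w => (bA w.1 + bB w.2, bC w.1 + bD w.2))
                          : dsum bHs U -> dsum bHs Y),
              forall x z, disk z -> bev (bA x) z = diskA phid (bh1 x) (bh2 x) z,
              forall u z, disk z -> bev (bB u) z = diskB phid u z,
              forall x, bC x = bh1 x 0
            & forall u, bD u = phid 0 u],
          unitary_op Xi,
          forall x m, rhp m.1 -> rhp m.2 ->
            split_eval hs1 hs2 (Xi x) m = Xi_fun a (bh1 x) (bh2 x) m
        & [/\ forall x, cayleyA (Ss phi hs1 hs2) a (Xi x) = Xi (bA x),
              forall u, cayleyB E a u = Xi (bB u),
              forall x, cayleyC (Ss phi hs1 hs2) a (Xi x) = bC x
            & forall u, cayleyD E a u = bD u]].
Proof.
have mod := rkhs_rhp_model phi_schur Hs_rkhs.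
split; first exact: (Ss_passive phi_schur mod).
split; first exact: (Ss_extrapolation phi_schur mod).
move=> E a ha; split.
  split.
  - exact: (cayley_unitary phi_schur mod E ha).
  - by move=> x m; exact: (cayleyAE phi_schur mod ha).
  - by move=> u m; exact: (cayleyBE phi_schur mod ha).
  - by move=> x; exact: (cayleyCE phi_schur mod ha).
  - by move=> u; exact: (cayleyDE phi_schur mod ha).
move=> bHs bh1 bh2 phid bev b_rkhs.
have c0 : sqrtC (2 * 'Re a) != 0 by rewrite lt0r_neq0// cayley_scale_gt0.
have bmod := disk_rhp_model ha b_rkhs.
have [Xi uXi XiE] := rhp_model_unitary phi_schur bmod mod.
have f_Xi x m : rhp m -> hs1 (Xi x) m = rhp_of_disk1 a bh1 x m by case/(XiE x).
have g_Xi x m : rhp m -> hs2 (Xi x) m = rhp_of_disk2 a bh2 x m by case/(XiE x).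
have [Xi' [uXi' Xi'K XiK]] := unitary_inv uXi.
pose S := Ss phi hs1 hs2.
(* The classical operators will be defined by conjugation with Xi, which makes the similarity
   immediate; these relations give their formulas. *)
have relA x : cayley_rel phi hs1 hs2 a (Xi x, 0)
    (Xi (Xi' (cayleyA S a (Xi x))), cayleyC S a (Xi x)).
  by rewrite Xi'K; exact: (cayley_rel_state phi_schur mod).
have relB u : cayley_rel phi hs1 hs2 a (Xi 0, u) (Xi (Xi' (cayleyB E a u)), cayleyD E a u).
  by rewrite Xi'K (unitary0 uXi); exact: (cayley_rel_input phi_schur mod).
have bC x : cayleyC S a (Xi x) = bh1 x 0.
  rewrite (cayleyCE phi_schur mod ha) f_Xi// /rhp_of_disk1 mobius_inv_at scalerA.
  rewrite mulrA cayley_scale_sqr addrC divff ?scale1r//.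
  by rewrite rhp_add_neq0//; exact: rhp_conj.
have bD u : cayleyD E a u = phid 0 u by rewrite (cayleyDE phi_schur mod ha) /phid mobius0.
have b0 z : disk z -> bh1 0 z = 0 /\ bh2 0 z = 0.
  by move=> hz; rewrite -(scale0r (0 : bHs)) (disk_Z1 b_rkhs)// (disk_Z2 b_rkhs)// !scale0r.
exists (fun x => Xi' (cayleyA S a (Xi x))), (fun u => Xi' (cayleyB E a u)),
  (fun x => cayleyC S a (Xi x)), (cayleyD E a), Xi; split.
- split=> //.
  + have -> : ((fun w => (Xi' (cayleyA S a (Xi w.1)) + Xi' (cayleyB E a w.2),
         cayleyC S a (Xi w.1) + cayleyD E a w.2)) : dsum bHs U -> dsum bHs Y) =
      ((fun w => (Xi' w.1, w.2)) : dsum Hs Y -> dsum bHs Y) \o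
      (cayley E a \o ((fun w => (Xi w.1, w.2)) : dsum bHs U -> dsum Hs U)).
      apply/funext => w; congr pair => /=.
      by have [lX _ _] := uXi'; rewrite -[X in X + _]scale1r -lX scale1r.
    apply: unitary_comp; first exact: unitary_dsum_id.
    by apply: unitary_comp; [exact: (cayley_unitary phi_schur mod) | exact: unitary_dsum_id].
  + move=> x z hz; have rel := disk_relation ha f_Xi g_Xi (relA x).
    congr pair => /=.
      apply/esym; apply: (disk_extend phi_schur ha b_rkhs) => // t ht t0.
      by have [-> _] := rel t ht; rewrite bC [phid t 0]linear0 addr0 scalerA divff ?scale1r//.
    by have [_ ->] := rel z hz; rewrite bC addr0.
  + move=> u z hz; have rel := disk_relation ha f_Xi g_Xi (relB u).
    congr pair => /=.
      apply/esym; apply: (disk_extend phi_schur ha b_rkhs) => // t ht t0.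
      have [-> _] := rel t ht; have [-> _] := b0 t ht.
      by rewrite bD scalerA divff// scale1r sub0r addrC.
    have [_ ->] := rel z hz; have [_ ->] := b0 z hz.
    by rewrite bD scaler0 sub0r addrC.
- exact: uXi.
- move=> x m h1 h2; congr pair => /=.
    by rewrite f_Xi// /rhp_of_disk1 -scalerA.
  by rewrite g_Xi// /rhp_of_disk2 -scalerA.
- by split=> // *; rewrite Xi'K.
Qed.
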